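(* Let $p>7$ be a prime and let $P$ be a partial latin square of order $p$ of the form \[ P=\{(i,c+i,s+i),\ (i,c'+i,s'+i),\ (i,c''+i,s''+i)\mid 0\le i<p\} \] for some distinct $c,c',c''$ and some distinct $s,s',s''$ (all arithmetic mod $p$). Then $P$ can be completed to a diagonally cyclic latin square of order $p$.
   Context: Triples $(r,t,u)$ denote symbol $u$ in row $r$, column $t$, with rows, columns and symbols in $\{0,\dots,p-1\}$. A latin square with operation $\circ$ of odd order $n$ is diagonally cyclic if $i\circ j=k$ implies $(i+1)\circ(j+1)=k+1$ for all cells. Completing $P$ means finding a latin square containing $P$ as a set of triples. *)

(* Defs.v *)
From HB Require Import structures.
From mathcomp Require Import all_boot all_order all_algebra.
Set Implicit Arguments. Unset Strict Implicit. Unset Printing Implicit Defensive.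
Import GRing.Theory.
Local Open Scope ring_scope.

(* Rows, columns and symbols are taken in 'Z_p = {0,...,p-1} with arithmetic mod p
   (p prime, so p >= 2 and 'Z_p is the genuine ring Z/pZ). *)

(* A set of triples (r,t,u) = "symbol u in row r, column t". *)
Definition triples (p : nat) := ('Z_p * 'Z_p * 'Z_p)%type -> Prop.

Definition partial_latin_square (p : nat) (P : triples p) : Prop :=
  forall r t u r' t' u', P (r, t, u) -> P (r', t', u') ->
    (r = r' -> t = t' -> u = u') /\
    (r = r' -> u = u' -> t = t') /\
    (t = t' -> u = u' -> r = r').

Definition latin_square (p : nat) (L : 'Z_p -> 'Z_p -> 'Z_p) : Prop :=
  (forall r, bijective (L r)) /\ (forall t, bijective (fun r => L r t)).

Definition diagonally_cyclic (p : nat) (L : 'Z_p -> 'Z_p -> 'Z_p) : Prop :=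
  forall i j, L (i + 1) (j + 1) = L i j + 1.

Definition contains (p : nat) (L : 'Z_p -> 'Z_p -> 'Z_p) (P : triples p) : Prop :=
  forall r t u, P (r, t, u) -> L r t = u.

Definition three_diag (p : nat) (c c' c'' s s' s'' : 'Z_p) : triples p :=
  fun x => exists i : 'Z_p,
    x = (i, c + i, s + i) \/ x = (i, c' + i, s' + i) \/ x = (i, c'' + i, s'' + i).

(* Main.v *)
Require Import Defs.
From HB Require Import structures.
From mathcomp Require Import all_boot all_order all_algebra.
From mathcomp Require Import cyclic finfield ring zify.
Import Order.TTheory GRing.Theory Num.Theory.
Local Open Scope ring_scope.
Set Implicit Arguments. Unset Strict Implicit. Unset Printing Implicit Defensive.

(** A diagonally cyclic latin square is [L r t = r + f (t - r)] for an orthomorphism [f]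
    (both [f] and [x |-> f x - x] are bijective), so an orthomorphism of F_p through three
    given points [P1], [P2], [P3] is needed.  If they are not collinear, take a point [O] on
    the line P1P2 and the map that is affine of slope that of P1P2 or of OP3, according to
    the quadratic character of the abscissa counted from [O].  It is an orthomorphism through
    the three points as soon as the character, counted from [O], takes one nonzero value on
    [P3] and on its horizontal and diagonal projections to P1P2, and does not take it on [P1]
    and [P2].  Counting the admissible [O] by character sums involves only sums over products
    of three linear factors, hence for p > 142 the Hasse bound provides one.

    The Hasse bound is obtained by Manin's method, which studies the degrees of the
    x-coordinates of the points P + nQ on a twist of the curve over F_q(X), where P comes from
    the Frobenius map.  Consecutive x-coordinates are the two roots of an explicit quadratic
    polynomial over F_q(X), so neither y-coordinates nor the group law are needed; their
    degrees form a quadratic polynomial in n, which must be nonnegative at every integer.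

    For p < 143 the existence of [O] is checked by computation, for the three choices of the
    pair {P1, P2}; the few remaining configurations lie on tabulated orthomorphisms. *)

(** * The chord relation between consecutive x-coordinates *)

Section ChordRelation.
Variables (F : fieldType) (r s : F).
Hypotheses (two_neq0 : 2%:R != 0 :> F).
Hypotheses (r_neq0 : r != 0) (s_neq0 : s != 0) (r_neq_s : r != s).

Let a : {poly F} := (- (r + s))%:P.
Let b : {poly F} := (r * s)%:P.
Let f : {poly F} := 'X * ('X - r%:P) * ('X - s%:P).

(* [A / B] and [A' / B'] are x-coordinates of points of the curve [f y^2 = x (x - r) (x - s)]
   over F(X), where [f := X (X - r) (X - s)]; they are in chord relation when the points
   differ by [(X, 1)], up to sign. *)
Definition chord_diff (A B : {poly F}) := A - 'X * B.
Definition chord_num (A B : {poly F}) := 'X * A - b * B.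
Definition chord_mid (A B : {poly F}) :=
  2%:R * ((A + 'X * B) * ('X * A + b * B) + 2%:R * a * 'X * A * B).
Definition chord_rel (A B A' B' : {poly F}) :=
  chord_diff A B ^+ 2 * A' ^+ 2 - chord_mid A B * A' * B'
    + chord_num A B ^+ 2 * B' ^+ 2 = 0.

Lemma chord_relC A B A' B' : chord_rel A B A' B' -> chord_rel A' B' A B.
Proof.
rewrite /chord_rel => <-; rewrite /chord_diff /chord_mid /chord_num; ring.
Qed.

Lemma cubicE : f = 'X * ('X ^+ 2 + a * 'X + b).
Proof. rewrite /f /a /b polyCN polyCD polyCM; ring. Qed.

(** At the roots [0], [r], [s] of [f], the polynomial [X^2 - b] takes the values [- r s],
    [r (r - s)], [s (s - r)]. Both polynomials come from the duplication formula
    [(X^2 - b)^2 / (4 f)]. *)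
Lemma coprime_cubic_X2b : coprimep f ('X ^+ 2 - b).
Proof.
rewrite coprimep_sym /f !coprimepMr coprimepX !coprimep_XsubC /root /b !hornerE.
rewrite expr0n /= sub0r oppr_eq0 mulf_neq0 //=.
rewrite [s ^+ 2]expr2 expr2 -mulrBr -mulrBl !mulf_neq0 // subr_eq0 //.
by rewrite eq_sym.
Qed.

Lemma four_polyC_coprime (P : {poly F}) : coprimep P (4%:R).
Proof.
rewrite (_ : 4%:R = (4%:R : F)%:P); last by rewrite polyCMn.
by rewrite -alg_polyC coprimepZr ?coprimep1 // (natrM _ 2 2) mulf_neq0.
Qed.

Lemma chord_mid_diag B : chord_mid ('X * B) B = 4%:R * f * B ^+ 2.
Proof. rewrite /chord_mid cubicE; ring. Qed.

(* The polynomial in [A' / B'] given by [chord_rel] is thus primitive, so that its two roots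
   [A' / B'] and [A'' / B''] satisfy [A' A'' = chord_num ^ 2] and [B' B'' = chord_diff ^ 2]. *)
Lemma chord_primitive A B P : coprimep A B ->
  P %| chord_diff A B ^+ 2 -> P %| chord_mid A B -> P %| chord_num A B ^+ 2 ->
  coprimep P P.
Proof.
move=> cAB PD PM PN.
(* [coprimep Q Q] says that [Q] is a nonzero constant. Modulo [chord_diff], [A] is ['X * B], so
   [chord_mid] becomes [4 f B^2] and [chord_num] becomes [(X^2 - b) B]; hence [Q] divides both [f]
   and [(X^2 - b)^2]. *)
have h Q : Q %| P -> Q %| chord_diff A B -> coprimep Q Q.
  move=> QP QD.
  have cQB : coprimep Q B.
    apply/coprimepP => d dQ dB; have /coprimepP := cAB; apply=> //.
    by rewrite -[A](subrK ('X * B)) dvdp_add ?dvdp_mull // (dvdp_trans dQ QD).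
  have cQf : Q %| f.
    have : Q %| 4%:R * f * B ^+ 2.
      have -> : 4%:R * f * B ^+ 2 = chord_mid A B - chord_diff A B *
        (2%:R * ('X * A + b * B + 2%:R * a * 'X * B) + 4%:R * 'X^2 * B).
        by rewrite /chord_mid /chord_diff cubicE; ring.
      by apply: dvdp_sub; [exact: dvdp_trans QP PM | exact: dvdp_mulr].
    rewrite Gauss_dvdpl ?coprimep_expr // Gauss_dvdpr //.
    exact: four_polyC_coprime.
  have : Q %| ('X ^+ 2 - b) ^+ 2.
    have : Q %| B ^+ 2 * ('X ^+ 2 - b) ^+ 2.
      have -> : B ^+ 2 * ('X ^+ 2 - b) ^+ 2 = chord_num A B ^+ 2 -
         chord_diff A B * ('X * (chord_num A B + ('X ^+ 2 - b) * B)).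
        rewrite /chord_num /chord_diff; ring.
      by apply: dvdp_sub; [exact: dvdp_trans QP PN | exact: dvdp_mulr].
    by rewrite Gauss_dvdpr ?coprimep_expr.
  move=> QX; apply: (coprimep_dvdl QX); apply: coprimep_expr.
  by apply: (coprimep_dvdr cQf); apply: coprime_cubic_X2b.
have cPD : coprimep P (chord_diff A B).
  have := h _ (dvdp_gcdl P (chord_diff A B)) (dvdp_gcdr _ _).
  by rewrite coprimepp /coprimep.
by apply: (coprimep_dvdl PD); apply: coprimep_expr.
Qed.

(** By Vieta, the quadratic with root [A' / B'] has a second root [A'' / B'']. Since
    [A' A'' = chord_num ^ 2] and [chord_num] has degree [deg A + 1], the degrees along the sequence
    have second difference 2. *)
Lemma chord_step A B A' B' :
    coprimep A B -> B != 0 -> (size B < size A)%N ->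
    coprimep A' B' -> B' != 0 -> (size B' < size A')%N ->
    chord_rel A B A' B' -> A != 'X * B ->
  exists A'' B'', [/\ coprimep A'' B'', B'' != 0, (size B'' < size A'')%N,
    chord_rel A'' B'' A B & (size A' + size A'' = (size A).+1.*2)%N].
Proof.
move=> cAB nzB ltBA cA'B' nzB' ltB'A' rel neqA.
have nzA : A != 0 by rewrite -size_poly_gt0 (leq_ltn_trans _ ltBA).
have nzA' : A' != 0 by rewrite -size_poly_gt0 (leq_ltn_trans _ ltB'A').
have dB' : B' %| chord_diff A B ^+ 2.
  rewrite -(@Gauss_dvdpl _ _ (A' ^+ 2)); last by rewrite coprimep_expr // coprimep_sym.
  move/eqP: rel; rewrite -addrA addr_eq0 => /eqP ->.
  by rewrite dvdpNr dvdp_add ?dvdpNr ?dvdp_mull // expr2 dvdp_mull.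
have dA' : A' %| chord_num A B ^+ 2.
  rewrite -(@Gauss_dvdpl _ _ (B' ^+ 2)); last by rewrite coprimep_expr.
  move/eqP: rel; rewrite addrC addr_eq0 => /eqP ->.
  by rewrite dvdpNr dvdp_sub ?dvdpNr //; [rewrite expr2 !dvdp_mull|rewrite dvdp_mulr // dvdp_mull].
set A'' := chord_num A B ^+ 2 %/ A'; set B'' := chord_diff A B ^+ 2 %/ B'.
have EA : A' * A'' = chord_num A B ^+ 2 by rewrite mulrC divpK.
have EB : B' * B'' = chord_diff A B ^+ 2 by rewrite mulrC divpK.
have EM : chord_mid A B = A' * B'' + A'' * B'.
  apply: (mulfI (mulf_neq0 nzA' nzB')); apply/eqP; rewrite -subr_eq0 -oppr_eq0; apply/eqP.
  move: rel; rewrite /chord_rel -EA -EB => <-; ring.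
have nzB'' : B'' != 0.
  apply: contraNneq neqA => B0; move: EB; rewrite B0 mulr0.
  by move=> /esym/eqP; rewrite expf_eq0 /= subr_eq0.
have szN : size (chord_num A B) = (size A).+1.
  have sXA : size ('X * A) = (size A).+1 by rewrite mulrC size_mulX.
  rewrite /chord_num size_polyDl ?sXA // size_polyN.
  by rewrite mul_polyC (leq_ltn_trans (size_scale_leq _ _)) // ltnS ltnW.
have nzN : chord_num A B != 0 by rewrite -size_poly_gt0 szN.
have nzA'' : A'' != 0.
  by apply: contraNneq nzN => A0; move: EA; rewrite A0 mulr0 => /esym/eqP; rewrite expf_eq0.
have szA : (size A' + size A'' = (size A).+1.*2)%N.
  have := congr1 (size : {poly F} -> nat) EA.
  rewrite expr2 !size_mul // szN /= => E.
  have arith x y z : ((x + y).-1 = (z.+1 + z.+1).-1)%N -> (0 < x)%N -> (0 < y)%N ->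
    (x + y = z.+1.*2)%N by clear; lia.
  by apply: arith E _ _; rewrite size_poly_gt0.
exists A'', B''; split => //.
- have := @chord_primitive A B (gcdp A'' B'') cAB.
  rewrite coprimepp /coprimep -EA -EB EM; apply.
  + by rewrite dvdp_mull // dvdp_gcdr.
  + by rewrite dvdp_add ?(dvdp_mull _ (dvdp_gcdr _ _)) ?(dvdp_mulr _ (dvdp_gcdl _ _)).
  + by rewrite dvdp_mull // dvdp_gcdl.
(* Otherwise, in [chord_mid = A' B'' + A'' B'], the term [A' B''] would have larger degree than the
   two others. *)
- rewrite ltnNge; apply/negP => le''.
  have szM : (size (chord_mid A B) <= (size A).*2)%N.
    have sXB : (size ('X * B)%R <= size A)%N by rewrite mulrC size_mulX.
    have sbB : (size (b * B)%R <= size A)%N.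
      by rewrite mul_polyC (leq_trans (size_scale_leq _ _)) // ltnW.
    have sXA : size ('X * A) = (size A).+1 by rewrite mulrC size_mulX.
    have H1 : (size (A + 'X * B)%R <= size A)%N.
      by apply: leq_trans (size_polyD _ _) _; rewrite geq_max leqnn.
    have H2 : (size ('X * A + b * B)%R <= (size A).+1)%N.
      by apply: leq_trans (size_polyD _ _) _; rewrite geq_max sXA leqnn ltnW.
    have H3 : (size (2%:R * a * 'X * A * B)%R <= (size A).*2)%N.
      rewrite (_ : _ * B = (- (r + s) *+ 2) *: (A * ('X * B))); last first.
        by rewrite /a -mul_polyC polyCMn; ring.
      apply: leq_trans (size_scale_leq _ _) _; apply: leq_trans (size_polyMleq _ _) _.
      have arith x y : (y <= x)%N -> ((x + y).-1 <= x.*2)%N by clear; lia.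
      exact: arith.
    rewrite /chord_mid mulr_natl -scaler_nat; apply: leq_trans (size_scale_leq _ _) _.
    apply: leq_trans (size_polyD _ _) _; rewrite geq_max H3 andbT.
    apply: leq_trans (size_polyMleq _ _) _.
    have arith x y z : (x <= z)%N -> (y <= z.+1)%N -> ((x + y).-1 <= z.*2)%N by clear; lia.
    exact: arith.
  have sA'B'' := size_mul nzA' nzB''.
  have sA''B' := size_mul nzA'' nzB'.
  move: EM => /eqP; rewrite -subr_eq => /eqP /(congr1 (size : {poly F} -> nat)) E.
  have := size_polyD (chord_mid A B) (- (A'' * B')); rewrite E size_polyN leq_max.
  rewrite sA'B'' sA''B'.
  have arith u u' v v' w m : (u + u' = w.+1.*2)%N -> (v < u)%N -> (0 < v)%N -> (0 < u')%N ->
    (u' <= v')%N -> (m <= w.*2)%N ->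
    ~~ (((u + v').-1 <= m) || ((u + v').-1 <= (u' + v).-1))%N by clear; lia.
  apply/negP; apply: (arith _ _ _ _ _ _ szA) => //; by rewrite size_poly_gt0.
- apply: chord_relC; rewrite /chord_rel EM -EA -EB; ring.
Qed.

(* Only the points [(X, 1)] and [(X, -1)] have x-coordinate [X], so [A / B] is that of their
   double. *)
Lemma chord_exceptional A B B' : coprimep A B -> B != 0 ->
  coprimep ('X * B') B' -> B' != 0 ->
  chord_rel ('X * B') B' A B -> size A = 5 /\ size ('X * B') = 2.
Proof.
move=> cAB nzB cB' nzB' rel.
have sB' : size B' = 1%N.
  by apply/eqP; move: cB'; rewrite coprimepMl coprimepp => /andP[].
split; last by rewrite mulrC size_mulX // sB'.
(* The duplication formula, cross-multiplied. Both fractions are reduced, so [A] is [(X^2 - b)^2] up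
   to a constant. *)
have E : ('X ^+ 2 - b) ^+ 2 * B = 4%:R * f * A.
  have nz : B' ^+ 2 * B != 0 by rewrite mulf_neq0 ?expf_neq0.
  apply: (mulfI nz); apply/eqP; rewrite -subr_eq0; apply/eqP; rewrite -[RHS]rel.
  rewrite chord_mid_diag /chord_diff /chord_num; ring.
have d1 : A %| ('X ^+ 2 - b) ^+ 2 by rewrite -(Gauss_dvdpl _ cAB) E dvdp_mull.
have d2 : ('X ^+ 2 - b) ^+ 2 %| A.
  suff cf : coprimep (('X ^+ 2 - b) ^+ 2) (4%:R * f).
    by rewrite -(Gauss_dvdpr _ cf) -E dvdp_mulr.
  by rewrite coprimepMr four_polyC_coprime coprimep_sym coprimep_expr // coprime_cubic_X2b.
have : A %= ('X ^+ 2 - b) ^+ 2 by rewrite /eqp d1 d2.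
have sX : size ('X ^+ 2 - b) = 3.
  by rewrite size_polyDl size_polyXn // size_polyN /b size_polyC; case: (_ != 0).
by move/eqp_size => ->; rewrite expr2 size_mul -?size_poly_gt0 sX.
Qed.

End ChordRelation.

(* The n-th x-coordinate after [A / B] has a numerator of degree [n^2 - d n + q]. *)
Lemma chord_height (F : fieldType) (r s : F) (A B A' B' : {poly F}) (q : nat) (d : int) :
    2%:R != 0 :> F -> r != 0 -> s != 0 -> r != s ->
    coprimep A B -> B != 0 -> (size B < size A)%N ->
    coprimep A' B' -> B' != 0 -> (size B' < size A')%N ->
    chord_rel r s A B A' B' -> A != 'X * B ->
    size A = q.+1 -> (size A')%:Z = q%:Z + 2 + d -> d ^+ 2 != 4 * q%:Z ->
  forall n : nat, 0 <= n%:Z ^+ 2 - d * n%:Z + q%:Z.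
Proof.
move=> h2 hr hs hrs cAB nzB ltBA cA'B' nzB' ltB'A' rel neqA szA szA' neq n.
suff [A1 [B1 [A0 [B0 [[_ _ ltBA1] _ [_ _ sz1 _]]]]]] : exists A1 B1 A0 B0,
   [/\ [/\ coprimep A1 B1, B1 != 0 & (size B1 < size A1)%N],
       [/\ coprimep A0 B0, B0 != 0 & (size B0 < size A0)%N] &
       [/\ chord_rel r s A1 B1 A0 B0, A1 != 'X * B1,
       (size A1)%:Z = n%:Z ^+ 2 - d * n%:Z + q%:Z + 1 &
       (size A0)%:Z = (n%:Z - 1) ^+ 2 - d * (n%:Z - 1) + q%:Z + 1]].
  have : (0 < (size A1)%:Z)%R by rewrite ltz_nat (leq_ltn_trans _ ltBA1).
  rewrite sz1; clear; lia.
elim: n => [|n [A1 [B1 [A0 [B0 [[c1 nz1 lt1] [c0 nz0 lt0] [rel1 neq1 sz1 sz0]]]]]]].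
  exists A, B, A', B'; split=> //; split=> //.
    by rewrite szA; clear; lia.
  by rewrite szA'; clear; lia.
have [A2 [B2 [c2 nz2 lt2 rel2 sz2]]] := chord_step h2 hr hs hrs c1 nz1 lt1 c0 nz0 lt0 rel1 neq1.
have sz2' : (size A2)%:Z = (n.+1)%:Z ^+ 2 - d * (n.+1)%:Z + q%:Z + 1.
  have /(congr1 Posz) : (size A0 + size A2)%N = ((size A1).+1.*2)%N by [].
  have arith (x y z : nat) (m e p : int) : x%:Z = m ^+ 2 - e * m + p + 1 ->
    y%:Z = (m - 1) ^+ 2 - e * (m - 1) + p + 1 -> Posz (y + z) = Posz (x.+1.*2) ->
    z%:Z = (m + 1) ^+ 2 - e * (m + 1) + p + 1 by clear; lia.
  by move=> /(arith _ _ _ _ _ _ sz1 sz0) ->; rewrite -[n.+1]addn1 PoszD.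
exists A2, B2, A1, B1; split=> //; split=> //; last first.
  by rewrite sz1; congr (_ ^+ 2 - d * _ + _ + _); clear; lia.
(* The recursion could stall only here. Sizes 5 and 2 at [n] and [n + 1] force [d = 2 n + 4] and
   [q = (n + 2)^2], that is [d^2 = 4 q]. *)
apply: contraNneq neq => eqA2; rewrite eqA2 in c2 rel2 sz2'.
have [s5 s2] := chord_exceptional h2 hr hs hrs c1 nz1 c2 nz2 rel2.
move: sz1 sz2'; rewrite s5 s2 => sz1 sz2'.
have arith (m e p : int) : 5 = m ^+ 2 - e * m + p + 1 ->
    2 = (m + 1) ^+ 2 - e * (m + 1) + p + 1 -> e ^+ 2 = 4 * p.
  clear=> E1 E2; have Ee : e = 2 * m + 4 by lia.
  rewrite {}Ee in E1 *; have -> : p = (m + 2) ^+ 2 by lia.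
  ring.
apply/eqP/(arith n%:Z d q%:Z sz1).
by move: sz2'; rewrite -[n.+1]addn1 PoszD.
Qed.

(** It suffices to take [n] next to the vertex [d / 2]. For [d = 2 m + 1] this gives
    [q >= m (m + 1)], and equality is impossible because [q] is odd. *)
Lemma quadratic_nonneg_discr (q : nat) (d : int) : odd q -> 0 <= d ->
  (forall n : nat, 0 <= n%:Z ^+ 2 - d * n%:Z + q%:Z) -> d ^+ 2 <= 4 * q%:Z.
Proof.
case: d => // d oq _ /(_ d./2) h.
have [od|ed] := boolP (odd d).
  have Ed : d = (d./2).*2.+1 by rewrite -[LHS]odd_double_half od.
  have neq : q <> (d./2 * (d./2).+1)%N.
    by move=> Eq; move: oq; rewrite Eq oddM /= andbN.
  move: (d./2) Ed neq h => m ->; clear; nia.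
have Ed : d = (d./2).*2 by rewrite -[LHS]odd_double_half (negPf ed).
move: (d./2) Ed h => m ->; clear; nia.
Qed.

(** * The Hasse bound for curves with full 2-torsion *)

(** With [T = X^k] and [S = g^k], this is [chord_rel] between [X^q] and [f H^2 / (X^q - X)^2],
    cleared of denominators. It holds because [g (S + e T)^2] is [E] plus a term whose square is
    [4 U g T^2]. *)
Lemma start_identity (R : comNzRingType) (X T g S e a b : R) :
    g = X ^+ 2 - a * X + b -> e ^+ 2 = 1 ->
    g * S ^+ 2 = X ^+ 2 * T ^+ 4 - a * X * T ^+ 2 + b ->
  (X * g) ^+ 2 * (S + e * T) ^+ 4
  - 2%:R * ((X * T ^+ 2 + X) * (X * (X * T ^+ 2) + b) - 2%:R * a * X * (X * T ^+ 2))
    * (X * g) * (S + e * T) ^+ 2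
  + (X * (X * T ^+ 2) - b) ^+ 2 * (X * T ^+ 2 - X) ^+ 2 = 0.
Proof.
move=> Eg Ee Eu.
pose U := X ^+ 2 * T ^+ 4 - a * X * T ^+ 2 + b; pose E := U + g * T ^+ 2.
have EQ : g * (S + e * T) ^+ 2 = E + e * (2%:R * g * S * T).
  transitivity (g * S ^+ 2 + e ^+ 2 * (g * T ^+ 2) + e * (2%:R * g * S * T)); first ring.
  by rewrite Ee mul1r Eu.
have EF : (e * (2%:R * g * S * T)) ^+ 2 = 4%:R * U * (g * T ^+ 2).
  transitivity (e ^+ 2 * (4%:R * (g * S ^+ 2) * (g * T ^+ 2))); first ring.
  by rewrite Ee mul1r Eu.
pose K := (T ^+ 2 + 1) * (X ^+ 2 * T ^+ 2 + b) - 2%:R * a * X * T ^+ 2.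
have EK : K = E by rewrite /K /E /U Eg; ring.
transitivity (X ^+ 2 * ((g * (S + e * T) ^+ 2) ^+ 2 - 2%:R * K * (g * (S + e * T) ^+ 2)
   + ((X ^+ 2 * T ^+ 2 - b) * (T ^+ 2 - 1)) ^+ 2)); first by rewrite /K; ring.
rewrite EK EQ; set P := e * _ in EF *.
transitivity (X ^+ 2 * (P ^+ 2 - E ^+ 2 + ((X ^+ 2 * T ^+ 2 - b) * (T ^+ 2 - 1)) ^+ 2)).
  ring.
by rewrite EF /E /U Eg; ring.
Qed.

Section OddFiniteField.
Variables (F : finFieldType) (k : nat).
Hypothesis cardF : #|F| = k.*2.+1.

Lemma odd_card_two_neq0 : 2%:R != 0 :> F.
Proof.
apply/eqP => two0.
have ch2 : 2 \in [pchar F] by rewrite inE two0 eqxx.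
have := card_pprimeChar ch2; rewrite cardF.
case: (logn _ _) => [E|n /(congr1 odd)]; last by rewrite /= odd_double oddX.
by have := finNzRing_gt1 F; rewrite cardF E.
Qed.

Lemma expf_half_sqr (x : F) : x != 0 -> (x ^+ k) ^+ 2 = 1.
Proof.
move=> nzx; rewrite -exprM muln2; apply: (mulIf nzx).
by rewrite mul1r -exprSr -cardF expf_card.
Qed.

Lemma expf_half_eq (x : F) : x != 0 -> (x ^+ k == 1) || (x ^+ k == -1).
Proof. by move=> /expf_half_sqr/eqP; rewrite sqrf_eq1. Qed.

Lemma half_card_gt0 : (0 < k)%N.
Proof. by have := finNzRing_gt1 F; rewrite cardF; case: (k). Qed.

Variables (r s : F).
Hypotheses (r_neq0 : r != 0) (s_neq0 : s != 0) (r_neq_s : r != s).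

Let fv (x : F) : F := x * (x - r) * (x - s).
Let f : {poly F} := 'X * ('X - r%:P) * ('X - s%:P).
Let g : {poly F} := ('X - r%:P) * ('X - s%:P).

(* Let [P := (X^q, f^k)] and [Q := (X, 1)].  The x-coordinate of [P - Q] or [P + Q],
   according to [e], is [g H^2 / (X (X^(q-1) - 1)^2)]; its reduced form is [Z^2 / (f Y^2)]
   for the quotient [Z := H / W]. *)
Section Start.
Variable e : F.
Hypothesis sign_sqr : e ^+ 2 = 1.

Let W : {poly F} := \prod_(x | fv x ^+ k == - e) ('X - x%:P).
Let Y : {poly F} := \prod_(x | fv x ^+ k == e) ('X - x%:P).
Let H : {poly F} := g ^+ k + e%:P * 'X^k.

Lemma sign_neq_opp : e != - e.
Proof.
rewrite -subr_eq0 opprK -mulr2n -mulr_natr mulf_neq0 ?odd_card_two_neq0 //.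
by apply: contra_eq_neq sign_sqr => ->; rewrite expr0n eq_sym oner_eq0.
Qed.

Lemma sign_neq0 : e != 0.
Proof. by apply: contra_eq_neq sign_sqr => ->; rewrite expr0n eq_sym oner_eq0. Qed.

Lemma sign_pm1 : (e == 1) || (e == -1).
Proof. by rewrite -sqrf_eq1 sign_sqr. Qed.

Lemma expf_half_cases (x : F) : x != 0 -> (x ^+ k == e) || (x ^+ k == - e).
Proof.
move/expf_half_eq; case/orP: sign_pm1 => /eqP -> //; by rewrite opprK orbC.
Qed.

(** The roots of [X^q - X] are all of [F], sorted by the value [0], [- e] or [e] of [fv x ^+ k]. *)
Lemma genPoly_class_factors : 'X ^+ k.*2.+1 - 'X = f * W * Y.
Proof.
rewrite -cardF finField_genPoly (bigID (fun x => fv x ^+ k == e)) /= mulrC; congr (_ * _).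
rewrite (bigID (fun x => fv x ^+ k == - e)) /= mulrC; congr (_ * _); last first.
  apply: eq_bigl => x; apply: andb_idl => /eqP ->.
  by rewrite eq_sym sign_neq_opp.
transitivity (\prod_(x | [|| x == 0, x == r | x == s]) ('X - x%:P)).
  apply: eq_bigl => x; rewrite -negb_or.
  have -> : ~~ ((fv x ^+ k == e) || (fv x ^+ k == - e)) = (fv x == 0).
    have [-> | nz] := eqVneq (fv x) 0; last by rewrite expf_half_cases.
    rewrite expr0n eqn0Ngt half_card_gt0 /= eq_sym (negPf sign_neq0) eq_sym oppr_eq0.
    by rewrite (negPf sign_neq0).
  by rewrite /fv !mulf_eq0 !subr_eq0 orbA.
rewrite (bigD1 0) ?eqxx //= (bigD1 r) ?eqxx ?orbT //= (bigD1 s); last first.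
  by rewrite eqxx !orbT s_neq0 eq_sym r_neq_s.
rewrite big1 /= ?mulr1 ?subr0 /f ?mulrA // => x.
by case: eqP => //=; case: eqP => //=; case: eqP.
Qed.

Lemma size_class_factors : (size W + size Y = k.*2)%N.
Proof.
have := congr1 (size : {poly F} -> nat) genPoly_class_factors.
have mW : W \is monic by apply: monic_prod => x _; apply: monicXsubC.
have mY : Y \is monic by apply: monic_prod => x _; apply: monicXsubC.
have mf : f \is monic by rewrite /f !rpredM ?monicX ?monicXsubC.
have sf : size f = 4.
  by rewrite /f !size_mul ?mulf_neq0 ?polyX_eq0 ?polyXsubC_eq0 // size_polyX !size_XsubC.
have [nzW nzY nzf] := And3 (monic_neq0 mW) (monic_neq0 mY) (monic_neq0 mf).
rewrite (size_mul (mulf_neq0 nzf nzW) nzY) (size_mul nzf nzW) sf.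
rewrite size_polyDl size_polyXn; last first.
  by rewrite size_polyN size_polyX !ltnS double_gt0 half_card_gt0.
have : (0 < size W)%N by rewrite size_poly_gt0 monic_neq0.
have : (0 < size Y)%N by rewrite size_poly_gt0 monic_neq0.
move: (size W) (size Y) => m n; clear; lia.
Qed.


Lemma size_start_num : size H = k.*2.+1.
Proof.
have nzg : g != 0 by rewrite /g mulf_neq0 ?polyXsubC_eq0.
have sg : size g = 3 by rewrite /g size_mul ?polyXsubC_eq0 // !size_XsubC.
have sgk : size (g ^+ k) = k.*2.+1.
  have := size_exp g k; rewrite sg /= -(ltn_predK (_ : 0 < size (g ^+ k)))%N.
    by rewrite mul2n => /= ->.
  by rewrite size_poly_gt0 expf_neq0.
rewrite /H size_polyDl sgk // mul_polyC (leq_ltn_trans (size_scale_leq _ _)) //.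
by rewrite size_polyXn ltnS; have := half_card_gt0; clear; lia.
Qed.

Lemma horner_start_num x : H.[x] = ((x - r) * (x - s)) ^+ k + e * x ^+ k.
Proof. by rewrite /H /g !hornerE. Qed.

(** At a root [x] of [W], multiplying [H.[x]] by [x ^+ k] gives [fv x ^+ k + e], which is 0. *)
Lemma class_factor_dvd_start_num : W %| H.
Proof.
rewrite /W -big_enum /=; apply: uniq_roots_dvdp; last by rewrite uniq_rootsE enum_uniq.
apply/allP => x; rewrite mem_enum => /eqP fx.
have nzx : x != 0.
  apply: contra_eq_neq fx => ->.
  by rewrite /fv !mul0r expr0n eqn0Ngt half_card_gt0 /= eq_sym oppr_eq0 sign_neq0.
rewrite /root horner_start_num; apply/eqP; apply: (mulIf (expf_neq0 k nzx)).
rewrite mul0r mulrDl -mulrA -expr2 expf_half_sqr // mulr1 -exprMn.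
by rewrite (_ : _ * x = fv x) ?fx ?addNr // /fv; ring.
Qed.

Let Z := H %/ W.

Lemma root_start_quotient x : root Z x -> H.[x] = 0.
Proof. by move=> /rootP Zx; rewrite -(divpK class_factor_dvd_start_num) hornerM Zx mul0r. Qed.

(** At a root [x] of [Y], [H] takes the value [2 e x^k]; at [0], [r] and [s] exactly one of its two
    terms survives. *)
Lemma coprime_start : coprimep (Z ^+ 2) (f * Y ^+ 2).
Proof.
apply: coprimep_expl; rewrite coprimepMr; apply/andP; split; last first.
  apply: coprimep_expr.
  rewrite /Y; elim/big_rec: _ => [|x P /eqP fx cP]; first exact: coprimep1.
  rewrite coprimepMr cP andbT coprimep_XsubC; apply/negP => /root_start_quotient /eqP.
  rewrite horner_start_num; apply/negP.
  have nzx : x != 0.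
    apply: contra_eq_neq fx => ->.
    by rewrite /fv !mul0r expr0n eqn0Ngt half_card_gt0 /= eq_sym sign_neq0.
  have -> : ((x - r) * (x - s)) ^+ k = e * x ^+ k.
    apply: (mulIf (expf_neq0 k nzx)).
    rewrite -mulrA -expr2 expf_half_sqr // mulr1 -exprMn.
    by rewrite (_ : _ * x = fv x) ?fx // /fv; ring.
  by rewrite -mulr2n -mulr_natr !mulf_neq0 ?odd_card_two_neq0 ?sign_neq0 ?expf_neq0.
rewrite /f !coprimepMr coprimepX !coprimep_XsubC -!andbA; apply/and3P; split.
- apply/negP => /root_start_quotient/eqP; rewrite horner_start_num.
  rewrite expr0n eqn0Ngt half_card_gt0 /= mulr0 addr0.
  by apply/negP; rewrite expf_neq0 // mulf_neq0 // sub0r oppr_eq0.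
- apply/negP => /root_start_quotient/eqP; rewrite horner_start_num.
  rewrite subrr mul0r expr0n eqn0Ngt half_card_gt0 /= add0r.
  by apply/negP; rewrite mulf_neq0 ?sign_neq0 ?expf_neq0.
- apply/negP => /root_start_quotient/eqP; rewrite horner_start_num.
  rewrite subrr mulr0 expr0n eqn0Ngt half_card_gt0 /= add0r.
  by apply/negP; rewrite mulf_neq0 ?sign_neq0 ?expf_neq0.
Qed.

(** The left side is [g^q], which the Frobenius map turns into [g] evaluated at
    [X^q = X (X^k)^2]. *)
Lemma frobenius_quadratic : g * (g ^+ k) ^+ 2 =
  'X ^+ 2 * ('X ^+ k) ^+ 4 - (r + s)%:P * 'X * ('X ^+ k) ^+ 2 + (r * s)%:P.
Proof.
rewrite -exprM muln2 -exprS -cardF /g exprMn.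
have XB (c : F) : ('X - c%:P) ^+ #|F| = 'X ^+ #|F| - c%:P.
  have [p pr_p pcharFp] := finPcharP F.
  have nat_q : [pchar {poly F}].-nat #|F|.
    rewrite (card_pprimeChar pcharFp) pnatX (eq_pnat _ (pchar_lalg _)) pnatE //.
    by rewrite pcharFp.
  by rewrite exprDn_pchar // exprNn_pchar // -rmorphXn /= expf_card.
rewrite !XB cardF exprS -muln2 exprM polyCD polyCM; ring.
Qed.

Lemma chord_rel_start : chord_rel r s ('X ^+ k.*2.+1) 1 (Z ^+ 2) (f * Y ^+ 2).
Proof.
have fE : f = 'X * g by rewrite /f /g mulrA.
have HZ : H = Z * W by rewrite divpK ?class_factor_dvd_start_num.
have nz : f * W ^+ 2 != 0.
  have nzW : W != 0 by rewrite monic_neq0 // monic_prod // => x _; apply: monicXsubC.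
  by rewrite mulf_neq0 ?expf_neq0 // /f !mulf_neq0 ?polyX_eq0 ?polyXsubC_eq0.
apply: (mulfI nz); rewrite mulr0 /chord_diff mulr1 genPoly_class_factors.
set M := chord_mid _ _ _ _; set N := chord_num _ _ _ _.
have E : f ^+ 2 * H ^+ 4 - M * f * H ^+ 2 + N ^+ 2 * ('X ^+ k.*2.+1 - 'X) ^+ 2 = 0.
  have Rg := frobenius_quadratic.
  have Xq : 'X ^+ k.*2.+1 = 'X * ('X ^+ k) ^+ 2 :> {poly F}.
    by rewrite exprS -muln2 exprM.
  rewrite /M /N /chord_mid /chord_num Xq fE /H.
  have ee : e%:P ^+ 2 = 1 by rewrite -rmorphXn /= sign_sqr.
  rewrite -[RHS](start_identity _ ee Rg) /g; last by rewrite polyCD polyCM; ring.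
  by rewrite polyCN; ring.
rewrite -[RHS](mulr0 (f * Y ^+ 2)) -E genPoly_class_factors HZ; ring.
Qed.

Lemma size_prod_XsubC_pred (P : pred F) : size (\prod_(x | P x) ('X - x%:P)) = #|P|.+1.
Proof. by rewrite -big_enum size_prod_XsubC -cardE. Qed.

(** [Z^2] has degree [2 (q - 1 - deg W)], which is [q + 1 + d] since [W] and [Y] have [q - 3] roots
    together. [chord_height] thus applies from [X^q / 1]; when [d^2 = 4 q] the bound is
    immediate. *)
Lemma half_hasse (d := #|[pred x | fv x ^+ k == e]|%:Z - #|[pred x | fv x ^+ k == - e]|%:Z) :
  0 <= d -> d ^+ 2 <= 4 * (k.*2.+1)%:Z.
Proof.
move=> d_ge0; have [-> // | neq] := eqVneq (d ^+ 2) (4 * (k.*2.+1)%:Z).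
apply: quadratic_nonneg_discr => //; first by rewrite /= odd_double.
have nzW : W != 0 by rewrite monic_neq0 // monic_prod // => x _; apply: monicXsubC.
have nzY : Y != 0 by rewrite monic_neq0 // monic_prod // => x _; apply: monicXsubC.
have nzf : f != 0 by rewrite /f !mulf_neq0 ?polyX_eq0 ?polyXsubC_eq0.
have nzZ : Z != 0.
  by rewrite dvdp_div_eq0 ?class_factor_dvd_start_num // -size_poly_gt0 size_start_num.
have sf : size f = 4.
  by rewrite /f !size_mul ?mulf_neq0 ?polyX_eq0 ?polyXsubC_eq0 // size_polyX !size_XsubC.
have sZ : (size Z + size W)%N = (k.*2.+2)%N.
  have := congr1 (size : {poly F} -> nat) (divpK class_factor_dvd_start_num).
  rewrite (size_mul nzZ nzW) size_start_num.
  have : (0 < size W)%N by rewrite size_poly_gt0.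
  move: (size W) (size Z) => m n; clear; lia.
have sZ2 : size (Z ^+ 2) = (size Z + size Z).-1 by rewrite expr2 size_mul.
have sB : size (f * Y ^+ 2) = (size Y + size Y + 2)%N.
  rewrite expr2 (size_mul nzf (mulf_neq0 nzY nzY)) (size_mul nzY nzY) sf.
  have : (0 < size Y)%N by rewrite size_poly_gt0.
  move: (size Y) => m; clear; lia.
have sWY := size_class_factors.
have [sW sY] : size W = #|[pred x | fv x ^+ k == - e]|.+1 /\
    size Y = #|[pred x | fv x ^+ k == e]|.+1.
  by split; apply: size_prod_XsubC_pred.
have ltBA : (size (f * Y ^+ 2)%R < size (Z ^+ 2)%R)%N.
  rewrite sB sZ2; move: sWY sZ; move: (size W) (size Z) (size Y); clear; lia.
apply: (chord_height odd_card_two_neq0 r_neq0 s_neq0 r_neq_s (coprimep1 _)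
  (oner_neq0 _) _ coprime_start _ _ chord_rel_start) => //.
- by rewrite size_poly1 size_polyXn.
- by rewrite mulf_neq0 ?expf_neq0.
- rewrite mulr1; apply/eqP => /(congr1 (size : {poly F} -> nat)).
  by rewrite size_polyXn size_polyX => -[]; have := half_card_gt0; clear; lia.
- by rewrite size_polyXn.
- rewrite sZ2 /d; move: sWY sZ; rewrite sW sY.
  have : (0 < size Z)%N by rewrite size_poly_gt0.
  move: (size Z) #|_| #|_|; clear; lia.
Qed.

End Start.

End OddFiniteField.

(** * The quadratic character and the Hasse bound as a character sum *)

Section QuadraticCharacter.
Variable F : finFieldType.
Hypothesis oddF : odd #|F|.

(** Euler's criterion: for [#|F|] odd, [#|F|./2] is [(q - 1) / 2]. *)
Definition quad_char (x : F) : int :=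
  if x == 0 then 0 else if x ^+ #|F|./2 == 1 then 1 else -1.
Local Notation chi := quad_char.

Lemma odd_card_half : #|F| = (#|F|./2).*2.+1.
Proof. by rewrite -[LHS]odd_double_half oddF. Qed.
Let cardF := odd_card_half.

Lemma quad_char0 : chi 0 = 0. Proof. by rewrite /quad_char eqxx. Qed.
Lemma quad_char1 : chi 1 = 1. Proof. by rewrite /quad_char oner_eq0 expr1n eqxx. Qed.

Lemma quad_char_eq0 x : (chi x == 0) = (x == 0).
Proof. by rewrite /quad_char; have [|_] := eqVneq x 0; [rewrite eqxx | case: ifP]. Qed.

Lemma one_neq_opp1 : (1 == -1 :> F) = false.
Proof.
apply/negbTE; rewrite -subr_eq0 opprK -[1 + 1]/(2%:R).
exact: odd_card_two_neq0 cardF.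
Qed.

Lemma quad_charM x y : chi (x * y) = chi x * chi y.
Proof.
have [->|nzx] := eqVneq x 0; first by rewrite mul0r quad_char0 mul0r.
have [->|nzy] := eqVneq y 0; first by rewrite mulr0 quad_char0 mulr0.
rewrite /quad_char mulf_eq0 (negPf nzx) (negPf nzy) /= exprMn.
have := expf_half_eq cardF nzx; have := expf_half_eq cardF nzy.
by do 2 (case/orP => /eqP ->);
  rewrite ?mulrN ?mulr1 ?mul1r ?opprK ?eqxx ?[-1 == 1]eq_sym ?one_neq_opp1.
Qed.

Lemma quad_charE x : chi x = (x ^+ #|F|./2 == 1)%:Z - (x ^+ #|F|./2 == -1)%:Z.
Proof.
rewrite /quad_char; have [->|nzx] := eqVneq x 0.
  rewrite expr0n eqn0Ngt (half_card_gt0 cardF) /= eq_sym oner_eq0 eq_sym oppr_eq0.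
  by rewrite oner_eq0.
by case/orP: (expf_half_eq cardF nzx) => /eqP ->; rewrite ?eqxx ?[-1 == 1]eq_sym one_neq_opp1.
Qed.

Lemma quad_char_values x : [\/ chi x = 0, chi x = 1 | chi x = -1].
Proof.
rewrite /quad_char; case: eqP => _; first by constructor 1.
by case: eqP => _; [constructor 2 | constructor 3].
Qed.

Lemma quad_char_sqr x : x != 0 -> chi (x ^+ 2) = 1.
Proof.
move=> nzx; rewrite expr2 quad_charM; case: (quad_char_values x) => [/eqP|->|->] //.
by rewrite quad_char_eq0 (negPf nzx).
Qed.

Lemma hasse_legendre (r s : F) : r != 0 -> s != 0 -> r != s ->
  (\sum_x chi (x * (x - r) * (x - s))) ^+ 2 <= 4 * #|F|%:Z.
Proof.
move=> r0 s0 rs.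
have H := half_hasse cardF r0 s0 rs.
have {H} [H1 H2] := (H 1 (expr1n _ _), H (-1) (sqrr_sign _ 1)).
rewrite opprK in H2; rewrite -cardF in H1 H2.
have cnt (P : pred F) : \sum_x (P x)%:Z = #|P|%:Z.
  rewrite -sum1_card (big_morph Posz PoszD (erefl _)) [RHS]big_mkcond.
  by apply: eq_bigr => x _; rewrite unfold_in; case: (P x).
rewrite (eq_bigr _ (fun x _ => quad_charE _)) sumrB !cnt.
(* [half_hasse] bounds a nonnegative difference, so [e] is 1 or -1 according to the sign of the
   sum. *)
case: (lerP 0 (#|[pred x | (x * (x - r) * (x - s)) ^+ #|F|./2 == 1]|%:Z
   - #|[pred x | (x * (x - r) * (x - s)) ^+ #|F|./2 == -1]|%:Z)) => h.
  exact: H1.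
by rewrite -sqrrN opprB; apply: H2; rewrite -opprB oppr_ge0 ltW.
Qed.

End QuadraticCharacter.

(** * Counting with the quadratic character *)

Section Separation.
Variable F : finFieldType.
Hypothesis oddF : odd #|F|.
Local Notation chi := (@quad_char F).
Let chiM := quad_charM oddF.

Lemma quad_char_norm_le1 x : `|chi x| <= 1.
Proof. by case: (quad_char_values x) => ->. Qed.

Lemma nonsquare_exists : exists z : F, chi z = -1.
Proof.
have k_gt0 := half_card_gt0 (odd_card_half oddF).
have : ~~ all (fun x : F => #|F|./2.-unity_root x) (enum (predC1 (0 : F))).
  apply/negP => h; have := max_unity_roots k_gt0 h (enum_uniq _).
  rewrite -cardE cardC1 {1}(odd_card_half oddF) /=; move: k_gt0; clear; lia.
case/allPn => z; rewrite mem_enum inE => nz; rewrite unity_rootE => nz1.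
by exists z; rewrite /quad_char (negPf nz) (negPf nz1).
Qed.

(** Multiplication by a nonsquare permutes [F] and negates the sum. *)
Lemma sum_quad_char : \sum_x chi x = 0.
Proof.
have [z cz] := nonsquare_exists.
have nz : z != 0 by rewrite -quad_char_eq0 cz.
suff : \sum_x chi x = - \sum_x chi x by clear; lia.
rewrite {1}(reindex_inj (mulfI nz)) /= -sumrN.
by apply: eq_bigr => x _; rewrite chiM cz mulN1r.
Qed.

Lemma sum_quad_char_linear (a : F) : a != 0 -> \sum_x chi (1 + a * x) = 0.
Proof.
move=> nza; rewrite -[RHS]sum_quad_char [RHS](reindex_inj (addrI 1)) /=.
by rewrite [RHS](reindex_inj (mulfI nza)).
Qed.

(** For [x != 0], [x (x + a)] is [x^2 (1 + a / x)]. The sum over [1 / x] is a full linear sum, which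
    vanishes, without its term 1 at 0. *)
Lemma sum_quad_char_shift (a : F) : a != 0 -> \sum_x chi (x * (x + a)) = -1.
Proof.
move=> nza.
have : \sum_x chi (1 + a * x^-1) = 0.
  by rewrite -[RHS](sum_quad_char_linear nza) [RHS](reindex_inj invr_inj).
rewrite (bigD1 0) //= invr0 mulr0 addr0 quad_char1 => h.
rewrite (bigD1 0) //= mul0r quad_char0 add0r.
transitivity (\sum_(x | x != 0) chi (1 + a * x^-1)); last first.
  by apply/eqP; rewrite -addr_eq0 addrC h.
apply: eq_bigr => x nzx.
rewrite (_ : x * (x + a) = x ^+ 2 * (1 + a * x^-1)); last by field.
by rewrite chiM quad_char_sqr // mul1r.
Qed.

Lemma sum_quad_char_pair (a b : F) : a != 0 -> b != 0 -> a != b ->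
  \sum_x chi ((1 + a * x) * (1 + b * x)) = - chi (a * b).
Proof.
move=> nza nzb neq.
have nzc : b^-1 - a^-1 != 0 by rewrite subr_eq0 (inj_eq invr_inj) eq_sym.
rewrite -[RHS]mulrN1 -(sum_quad_char_shift nzc) big_distrr /=.
rewrite [RHS](reindex_inj (addIr a^-1)) /=; apply: eq_bigr => x _.
by rewrite -chiM; congr (chi _); field; rewrite nza nzb.
Qed.

Lemma hasse_triple (a b c : F) : a != 0 -> b != 0 -> c != 0 ->
    a != b -> a != c -> b != c ->
  (\sum_x chi ((1 + a * x) * (1 + b * x) * (1 + c * x))) ^+ 2 <= 4 * #|F|%:Z.
Proof.
move=> nza nzb nzc ab ac bc.
have r0 : a^-1 - b^-1 != 0 by rewrite subr_eq0 (inj_eq invr_inj).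
have s0 : a^-1 - c^-1 != 0 by rewrite subr_eq0 (inj_eq invr_inj).
have rs : a^-1 - b^-1 != a^-1 - c^-1.
  by rewrite (inj_eq (addrI _)) (inj_eq oppr_inj) (inj_eq invr_inj).
have := hasse_legendre oddF r0 s0 rs.
rewrite (reindex_inj (addIr a^-1)) /=.
have -> : \sum_x chi ((1 + a * x) * (1 + b * x) * (1 + c * x)) = chi (a * b * c) *
   \sum_x chi ((x + a^-1) * (x + a^-1 - (a^-1 - b^-1)) * (x + a^-1 - (a^-1 - c^-1))).
  rewrite big_distrr /=; apply: eq_bigr => x _; rewrite -chiM; congr (chi _).
  by field; rewrite nza nzb nzc.
have nz : a * b * c != 0 by rewrite !mulf_neq0.
by case: (quad_char_values (a * b * c)) => [/eqP|->|->];
  rewrite ?quad_char_eq0 ?(negPf nz) // ?mul1r // mulN1r sqrrN.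
Qed.

(* A fourth power is a square, so inverting the variable, translating and inverting again
   turns four linear factors into three. *)
Lemma quad_char_quartic_sum (a b c d : F) :
  \sum_x chi ((1 + a * x) * (1 + b * x) * (1 + c * x) * (1 + d * x)) =
  \sum_x chi ((1 + (a - d) * x) * (1 + (b - d) * x) * (1 + (c - d) * x))
  - chi (a * b * c * d).
Proof.
have inv_sum (h : F -> int) : \sum_(x | x != 0) h x = \sum_(x | x != 0) h x^-1.
  by rewrite (reindex_inj invr_inj) /=; apply: eq_bigl => x; rewrite invr_eq0.
rewrite (bigD1 0) //= !mulr0 !addr0 !mulr1 quad_char1.
rewrite inv_sum (eq_bigr (fun x => chi ((x + a) * (x + b) * (x + c) * (x + d)))); last first.
  move=> x nzx; rewrite (_ : (1 + a * x^-1) * (1 + b * x^-1) * (1 + c * x^-1) * (1 + d * x^-1) =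
     ((x + a) * (x + b) * (x + c) * (x + d)) * ((x^-1) ^+ 2) ^+ 2); last by field.
  by rewrite chiM quad_char_sqr ?mulr1 // expf_neq0 // invr_eq0.
have E1 : \sum_x chi ((x + a) * (x + b) * (x + c) * (x + d)) =
  chi (a * b * c * d) + \sum_(x | x != 0) chi ((x + a) * (x + b) * (x + c) * (x + d)).
  by rewrite (bigD1 0) //= !add0r.
have E2 : \sum_x chi ((x + a) * (x + b) * (x + c) * (x + d)) =
  \sum_(x | x != 0) chi ((1 + (a - d) * x) * (1 + (b - d) * x) * (1 + (c - d) * x)).
  rewrite (reindex_inj (addIr (- d))) /= (bigD1 0) //= add0r addNr mulr0 quad_char0 add0r.
  rewrite [RHS]inv_sum; apply: eq_bigr => x nzx.
  rewrite (_ : (x - d + a) * (x - d + b) * (x - d + c) * (x - d + d) =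
    (1 + (a - d) * x^-1) * (1 + (b - d) * x^-1) * (1 + (c - d) * x^-1) * (x ^+ 2) ^+ 2);
    last by field.
  by rewrite chiM quad_char_sqr ?mulr1 // expf_neq0.
have E3 : \sum_x chi ((1 + (a - d) * x) * (1 + (b - d) * x) * (1 + (c - d) * x)) =
  1 + \sum_(x | x != 0) chi ((1 + (a - d) * x) * (1 + (b - d) * x) * (1 + (c - d) * x)).
  by rewrite (bigD1 0) //= !mulr0 !addr0 !mulr1 quad_char1.
by rewrite E3 -E2 E1; ring.
Qed.

(** If no [x] fits, [term] vanishes except at [- 1 / a] and [- 1 / b], where it is at most 8, so its
    sum is at most 16. Expanding the product shows that the sum is [q] up to five cubic sums and
    seven character values. *)
Lemma sign_pattern_exists (a b c d : F) : (143 <= #|F|)%N ->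
    a != 0 -> b != 0 -> c != 0 -> d != 0 ->
    [/\ a != b, a != c & a != d] -> [/\ b != c, b != d & c != d] ->
  exists x, [/\ x != 0, chi (1 + a * x) = 1, chi (1 + b * x) = 1,
    chi (1 + c * x) != 1 & chi (1 + d * x) != 1].
Proof.
move=> q_ge nza nzb nzc nzd [ab ac ad] [bc bd cd].
pose term (x : F) : int := (1 + chi (1 + a * x)) * (1 + chi (1 + b * x))
  * (1 - chi (1 + c * x)) * (1 - chi (1 + d * x)).
have [/existsP[x /and5P[h1 /eqP h2 /eqP h3 h4 h5]]|none] := boolP [exists x,
  [&& x != 0, chi (1 + a * x) == 1, chi (1 + b * x) == 1,
    chi (1 + c * x) != 1 & chi (1 + d * x) != 1]]; first by exists x.
exfalso.
have term_le (x : F) : (x == - a^-1) || (x == - b^-1) -> term x <= 8.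
  have root (e : F) : e != 0 -> 1 + e * - e^-1 = 0 by move=> nze; rewrite mulrN mulfV // subrr.
  move=> xab; have [ha|hb] : chi (1 + a * x) = 0 \/ chi (1 + b * x) = 0.
    by case/orP: xab => /eqP ->; rewrite root // quad_char0; [left | right].
  - rewrite /term ha; case: (quad_char_values (1 + b * x)) => ->;
    case: (quad_char_values (1 + c * x)) => ->; by case: (quad_char_values (1 + d * x)) => ->.
  - rewrite /term hb; case: (quad_char_values (1 + a * x)) => ->;
    case: (quad_char_values (1 + c * x)) => ->; by case: (quad_char_values (1 + d * x)) => ->.
have term0 (x : F) : ~~ ((x == - a^-1) || (x == - b^-1)) -> term x = 0.
  rewrite negb_or => /andP[xa xb].
  have lin (e : F) : e != 0 -> x != - e^-1 -> 1 + e * x != 0.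
    move=> nze; apply: contraNneq => h; apply/eqP/(mulfI nze).
    by rewrite mulrN mulfV //; apply/eqP; rewrite -addr_eq0 addrC h.
  have := lin _ nza xa; have := lin _ nzb xb; rewrite -!quad_char_eq0 => ha hb.
  have /existsPn /(_ x) nx := none; rewrite /term.
  have [x0|nzx] := eqVneq x 0; first by rewrite x0 !mulr0 !addr0 quad_char1 subrr mulr0.
  move: nx; rewrite nzx /=.
  case: (quad_char_values (1 + a * x)) hb => -> // _; last by rewrite subrr !mul0r.
  case: (quad_char_values (1 + b * x)) ha => -> // _; last by rewrite subrr !(mul0r, mulr0).
  rewrite !eqxx /= negb_and !negbK => /orP[/eqP->|/eqP->]; by rewrite subrr !(mul0r, mulr0).
have upper : \sum_x term x <= 16.
  rewrite (bigID (fun x => (x == - a^-1) || (x == - b^-1))) /=.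
  rewrite [X in _ + X]big1; last exact: term0.
  rewrite addr0; apply: le_trans (ler_sum _ term_le) _.
  have : (#|[pred x : F | (x == - a^-1) || (x == - b^-1)]| <= 2)%N.
    by apply: leq_trans (card_size [:: - a^-1; - b^-1]); apply/eq_leq/eq_card => x; rewrite !inE.
  by rewrite sumr_const -mulr_natr; move: #|_| => m /=; clear; lia.
pose T (x y z : F) : int := \sum_t chi ((1 + x * t) * (1 + y * t) * (1 + z * t)).
have expand : \sum_x term x = #|F|%:Z + 
    (- chi (a * b) + chi (a * c) + chi (a * d) + chi (b * c) + chi (b * d) - chi (c * d))
    - T a b c - T a b d + T a c d + T b c d
    + (T (a - d) (b - d) (c - d) - chi (a * b * c * d)).
  rewrite -quad_char_quartic_sum.
  have := sum_quad_char_linear nza; have := sum_quad_char_linear nzb.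
  have := sum_quad_char_linear nzc; have := sum_quad_char_linear nzd.
  have := sum_quad_char_pair nza nzb ab; have := sum_quad_char_pair nza nzc ac.
  have := sum_quad_char_pair nza nzd ad; have := sum_quad_char_pair nzb nzc bc.
  have := sum_quad_char_pair nzb nzd bd; have := sum_quad_char_pair nzc nzd cd.
  have -> : \sum_x term x = 
    \sum_(x : F) 1 + \sum_x chi (1 + a * x) + \sum_x chi (1 + b * x)
    - \sum_x chi (1 + c * x) - \sum_x chi (1 + d * x)
    + \sum_x chi ((1 + a * x) * (1 + b * x)) - \sum_x chi ((1 + a * x) * (1 + c * x))
    - \sum_x chi ((1 + a * x) * (1 + d * x)) - \sum_x chi ((1 + b * x) * (1 + c * x))
    - \sum_x chi ((1 + b * x) * (1 + d * x)) + \sum_x chi ((1 + c * x) * (1 + d * x))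
    - T a b c - T a b d + T a c d + T b c d
    + \sum_x chi ((1 + a * x) * (1 + b * x) * (1 + c * x) * (1 + d * x)).
    rewrite /T -!(sumrB, big_split) /=; apply: eq_bigr => x _.
    by rewrite /term !chiM; ring.
  do 10 move=> ->; rewrite sumr_const -/(_ *+ _) pmulrn; ring.
(* The five cubic sums then cost at most [q - 24] and the seven character values at most 7, leaving
   at least 17. The threshold 143 ensures [(q - 23)^2 > 100 q]. *)
have bnd (x y z : F) : x != 0 -> y != 0 -> z != 0 -> x != y -> x != z -> y != z ->
    `|T x y z| * 5 <= #|F|%:Z - 24.
  move=> x0 y0 z0 xy xz yz.
  have := hasse_triple x0 y0 z0 xy xz yz; rewrite -/(T x y z) => h.
  have {}h : `|T x y z| ^+ 2 <= 4 * #|F|%:Z by rewrite -normrX ger0_norm ?sqr_ge0.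
  move: (normr_ge0 (T x y z)) q_ge h; move: `|T x y z| #|F| => n q; clear => n0 q_ge h.
  rewrite leNgt; apply/negP => lt.
  have h1 : q%:Z - 23 <= n * 5 by lia.
  have h2 : (q%:Z - 23) * (q%:Z - 23) <= (n * 5) * (n * 5) by apply: ler_pM => //; lia.
  have h3 : 0 <= (q%:Z - 143) * (q%:Z - 3) by apply: mulr_ge0; lia.
  lia.
have sd (x y : F) : x != y -> x - y != 0 by rewrite subr_eq0.
have sde (x y z : F) : x != y -> x - z != y - z by rewrite (inj_eq (addIr _)).
have := bnd _ _ _ nza nzb nzc ab ac bc.
have := bnd _ _ _ nza nzb nzd ab ad bd.
have := bnd _ _ _ nza nzc nzd ac ad cd.
have := bnd _ _ _ nzb nzc nzd bc bd cd.
have := bnd _ _ _ (sd _ _ ad) (sd _ _ bd) (sd _ _ cd) (sde _ _ d ab) (sde _ _ d ac) (sde _ _ d bc).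
have := quad_char_norm_le1 (a * b); have := quad_char_norm_le1 (a * c).
have := quad_char_norm_le1 (a * d); have := quad_char_norm_le1 (b * c).
have := quad_char_norm_le1 (b * d); have := quad_char_norm_le1 (c * d).
have := quad_char_norm_le1 (a * b * c * d).
move: upper; rewrite expand.
move: (chi _) (chi _) (chi _) (chi _) (chi _) (chi _) (chi _)
  (T _ _ _) (T _ _ _) (T _ _ _) (T _ _ _) (T _ _ _).
clear; lia.
Qed.

(** [t] is the abscissa of the centre, [a] that of the point off the line, [b] and [c] those of its
    projections, [d] and [e] those of the two points on the line. *)
Definition separated (a b c d e : F) := exists t,
  [/\ chi (a - t) != 0, chi (b - t) = chi (a - t), chi (c - t) = chi (a - t),
      chi (d - t) != chi (a - t) & chi (e - t) != chi (a - t)].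

Lemma separated_large (a b c d e : F) : (143 <= #|F|)%N ->
  uniq [:: a; b; c; d; e] -> separated a b c d e.
Proof.
move=> q_ge; rewrite /= !inE !negb_or.
move=> /and5P[/and4P[ab ac ad ae] /and3P[bc bd be] /andP[cd ce] de _].
have sd (x y : F) : x != y -> y - x != 0 by rewrite subr_eq0 eq_sym.
have sde (x y z : F) : x != y -> x - z != y - z by rewrite (inj_eq (addIr _)).
have [|x [nzx hb hc hd he]] := sign_pattern_exists q_ge
   (sd _ _ ab) (sd _ _ ac) (sd _ _ ad) (sd _ _ ae)
   (And3 (sde _ _ a bc) (sde _ _ a bd) (sde _ _ a be)).
  by split; apply: sde.
(* With the centre [a - 1 / x], all five characters share the factor [chi x^-1], which cancels. *)
have E y : y - (a - x^-1) = x^-1 * (1 + (y - a) * x) by field.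
have nzc : chi x^-1 != 0 by rewrite quad_char_eq0 invr_eq0.
have Ea : chi (a - (a - x^-1)) = chi x^-1 by rewrite opprB addrC subrK.
exists (a - x^-1); rewrite Ea !E !chiM hb hc !mulr1; split=> //.
  by rewrite -[X in _ != X]mulr1 (inj_eq (mulfI nzc)).
by rewrite -[X in _ != X]mulr1 (inj_eq (mulfI nzc)).
Qed.

End Separation.

(** * Quadratic orthomorphisms *)

Definition orthomorphism (V : zmodType) (f : V -> V) :=
  injective f /\ injective (fun x => f x - x).

(* Besides the origin, the graph of [f] contains the points of abscissae [m] and [n] of the
   line through [(1, 0)] and [(h, h)], the projections of the origin. *)
Definition fits_normalized (F : fieldType) (h m n : F) := exists f : F -> F,
  [/\ orthomorphism f, f 0 = 0, (h - 1) * f m = h * (m - 1) & (h - 1) * f n = h * (n - 1)].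

Lemma fits_normalizedC (F : fieldType) (h m n : F) :
  fits_normalized h n m -> fits_normalized h m n.
Proof. by case=> f [h1 h2 h3 h4]; exists f. Qed.

Lemma orthomorphism_line (F : fieldType) (al ga : F) : al != 0 -> al != 1 ->
  orthomorphism (fun x => al * x + ga).
Proof.
move=> al0 al1; split=> x y; first by move=> /addIr /(mulfI al0).
have al10 : al - 1 != 0 by rewrite subr_eq0.
have E z : al * z + ga - z = (al - 1) * z + ga by ring.
by rewrite /= !E => /addIr /(mulfI al10).
Qed.

(** Translations, and scaling both coordinates alike, preserve orthomorphisms; they bring the third
    point to the origin. If the points are collinear, the affine map itself serves. *)
Lemma three_points_orthomorphism (F : fieldType) (x1 y1 x2 y2 x3 y3 : F) :
    (forall h m n : F, uniq [:: 0; 1; h; m; n] -> fits_normalized h m n) ->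
    uniq [:: x1; x2; x3] -> uniq [:: y1; y2; y3] -> uniq [:: y1 - x1; y2 - x2; y3 - x3] ->
  exists f : F -> F, [/\ orthomorphism f, f x1 = y1, f x2 = y2 & f x3 = y3].
Proof.
move=> H; rewrite /= !inE !negb_or !andbT.
move=> /andP[/andP[x12 x13] x23] /andP[/andP[y12 y13] y23] /andP[/andP[d12 d13] d23].
have nx : x2 - x1 != 0 by rewrite subr_eq0 eq_sym.
pose al := (y2 - y1) / (x2 - x1); pose ga := y1 - al * x1.
have Ey1 : y1 = al * x1 + ga by rewrite /ga; ring.
have Ey2 : y2 = al * x2 + ga by rewrite /ga /al; field.
have al0 : al != 0.
  by apply: contraNneq y12 => al0; rewrite Ey1 Ey2 al0 !mul0r.
have al1 : al - 1 != 0.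
  apply: contraNneq d12 => /eqP; rewrite subr_eq0 => /eqP al1; apply/eqP.
  by rewrite Ey1 Ey2 al1; ring.
have [Ey3|off] := eqVneq y3 (al * x3 + ga).
  exists (fun x => al * x + ga); split=> //; apply: orthomorphism_line => //.
  by rewrite -subr_eq0.
(* The unit of length is chosen so that the horizontal projection of the third point
   onto the line through the first two has abscissa 1. *)
pose l := (y3 - ga) / al - x3.
have l0 : l != 0.
  apply: contraNneq off => l0; apply/eqP.
  have -> : x3 = (y3 - ga) / al by apply/eqP; rewrite eq_sym -subr_eq0 -/l l0.
  by field.
(* [D] is the abscissa of the diagonal projection of the third point. Its normalized value [h]
   satisfies [h (al - 1) = al], so the line has slope [h / (h - 1)]. *)
pose D := (y3 - x3 - ga) / (al - 1).
have ED : (al - 1) * D + ga = y3 - x3 by rewrite /D; field.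
have Ey3 : y3 = al * (l + x3) + ga by rewrite /l; field.
have Eh : (D - x3) / l * (al - 1) = al by rewrite /D Ey3; field; rewrite l0 al1.
have sc (x y : F) : ((x - x3) / l == (y - x3) / l) = (x == y).
  by rewrite (inj_eq (mulIf _)) ?invr_eq0 // (inj_eq (addIr _)).
have [|f [[inj1 inj2] f0 fm fn]] := H ((D - x3) / l) ((x1 - x3) / l) ((x2 - x3) / l).
  have E0 : 0 = (x3 - x3) / l by rewrite subrr mul0r.
  have E1 : 1 = (l + x3 - x3) / l by rewrite addrK mulfV.
  rewrite (_ : [:: 0; _; _; _; _] = [seq (x - x3) / l | x <- [:: x3; l + x3; D; x1; x2]]);
    last by rewrite /= -E0 -E1.
  rewrite map_inj_uniq; last by move=> x y /eqP; rewrite sc => /eqP.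
  have nD x y : y = al * x + ga -> y - x != y3 - x3 -> D != x.
    by move=> Exy; apply: contraNneq => Dx; rewrite -ED Exy Dx; apply/eqP; ring.
  have nH x y : y = al * x + ga -> y != y3 -> l + x3 != x.
    by move=> Exy; apply: contraNneq => Hx; rewrite Ey3 Exy Hx.
  rewrite /= !inE !negb_or !andbT (nD _ _ Ey1) // (nD _ _ Ey2) // (nH _ _ Ey1) // (nH _ _ Ey2) //.
  rewrite x12 [x3 == x1]eq_sym x13 [x3 == x2]eq_sym x23 /= !andbT -andbA; apply/and3P; split.
  - by rewrite -subr_eq0 opprD addrCA subrr addr0 oppr_eq0.
  - apply: contraNneq off => Dx; apply/eqP.
    transitivity (y3 - x3 + x3); first by ring.
    by rewrite -ED -Dx; ring.
  - apply: contraNneq l0 => EDx; apply/eqP.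
    transitivity (al * (l + x3) + ga - ((al - 1) * D + ga) - x3); first by rewrite -EDx; ring.
    by rewrite -Ey3 ED; ring.
set h := (D - x3) / l in Eh fm fn *.
have h1 : h - 1 != 0.
  apply: contraNneq (oner_neq0 F) => /eqP; rewrite subr_eq0 => /eqP h1.
  move: Eh; rewrite h1 mul1r => e.
  by apply/eqP; rewrite -(subrr al) -{2}e; ring.
have fval x : (h - 1) * f ((x - x3) / l) = h * ((x - x3) / l - 1) ->
    y3 + l * f ((x - x3) / l) = al * x + ga.
  move=> e; apply: (mulfI h1).
  have -> : (h - 1) * (y3 + l * f ((x - x3) / l)) =
    (h - 1) * y3 + l * ((h - 1) * f ((x - x3) / l)) by ring.
  rewrite e.
  have -> : (h - 1) * y3 + l * (h * ((x - x3) / l - 1)) = (h - 1) * y3 + h * (x - x3 - l) by field.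
  have Eh' : (h - 1) * al = h.
    by transitivity (h * (al - 1) + h - al); [ring | rewrite Eh; ring].
  rewrite Ey3.
  transitivity ((h - 1) * al * (l + x3) + (h - 1) * ga + h * (x - x3 - l)); first by ring.
  transitivity ((h - 1) * al * x + (h - 1) * ga); last by ring.
  by rewrite Eh'; ring.
exists (fun x => y3 + l * f ((x - x3) / l)); split.
- split=> x y.
    by move=> /addrI /(mulfI l0) /inj1 /eqP; rewrite sc => /eqP.
  have E z : y3 + l * f ((z - x3) / l) - z =
      y3 - x3 + l * (f ((z - x3) / l) - (z - x3) / l) by field.
  by rewrite /= !E => /addrI /(mulfI l0) /inj2 /eqP; rewrite sc => /eqP.
- by rewrite fval.
- by rewrite fval.
- by rewrite subrr mul0r f0 mulr0 addr0.
Qed.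

Section QuadraticOrthomorphism.
Variable F : finFieldType.
Hypothesis oddF : odd #|F|.
Local Notation chi := (@quad_char F).

(** Both slopes multiply the character by the same sign, so points treated with different slopes
    have images of different characters. *)
Lemma two_slopes_inj (t al be : F) (sg : int) : chi al = chi be -> al != 0 -> sg != 0 ->
  injective (fun x => (if chi (x - t) == sg then be else al) * (x - t)).
Proof.
move=> Eab al0 sg0.
have be0 : be != 0 by rewrite -quad_char_eq0 -Eab quad_char_eq0.
have cal0 : chi al != 0 by rewrite quad_char_eq0.
have mixed x y : chi (x - t) == sg -> chi (y - t) != sg -> be * (x - t) = al * (y - t) -> False.
  move=> /eqP hx /eqP hy /(congr1 chi); rewrite !quad_charM // hx -Eab => /(mulfI cal0).
  by move/esym.
move=> x y /=; case: ifPn => hx; case: ifPn => hy.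
- by move=> /(mulfI be0) /addIr.
- by move=> /(mixed _ _ hx hy).
- by move=> /esym /(mixed _ _ hy hx).
- by move=> /(mulfI al0) /addIr.
Qed.

(* [h] and [d] are the abscissae of the horizontal and diagonal projections of [(x3, y3)]
   onto the line [y = al x + ga].  Seen from the centre [t] of the orthomorphism, the
   equality of the characters of [x3 - t], [h - t] and [d - t] says that the two slopes,
   and the two slopes minus one, have the same quadratic character. *)
Lemma quadratic_orthomorphism (al ga h d x1 x2 x3 y3 : F) : al != 0 -> al != 1 ->
    al * h + ga = y3 -> (al - 1) * d + ga = y3 - x3 -> separated x3 h d x1 x2 ->
  exists f, [/\ orthomorphism f, f x1 = al * x1 + ga, f x2 = al * x2 + ga & f x3 = y3].
Proof.
move=> al0 al1 Eh Ed [t [sg0 chh chd ch1 ch2]].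
have x3t : x3 - t != 0 by rewrite -quad_char_eq0.
have al10 : al - 1 != 0 by rewrite subr_eq0.
(* [u] is the ordinate of the centre on the line, and [be] the slope from the centre to
   [(x3, y3)]. *)
pose u := al * t + ga; pose be := (y3 - u) / (x3 - t).
have Ebe : be * (x3 - t) = al * (h - t) by rewrite /be /u -Eh; field.
have Ebe1 : (be - 1) * (x3 - t) = (al - 1) * (d - t).
  rewrite mulrBl Ebe mul1r.
  have -> : al * (h - t) = al * h + ga - ga - al * t by ring.
  have -> : (al - 1) * (d - t) = (al - 1) * d + ga - ga - al * t + t by ring.
  by rewrite Eh Ed; ring.
have cbe : chi al = chi be.
  by apply: (mulIf sg0); rewrite -{1}chh -!quad_charM // Ebe.
have cbe1 : chi (al - 1) = chi (be - 1).
  by apply: (mulIf sg0); rewrite -{1}chd -!quad_charM // Ebe1.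
exists (fun x => u + (if chi (x - t) == chi (x3 - t) then be else al) * (x - t)); split.
- split=> x y; first by move=> /addrI /(two_slopes_inj cbe al0 sg0).
  have E z : u + (if chi (z - t) == chi (x3 - t) then be else al) * (z - t) - z =
     u - t + (if chi (z - t) == chi (x3 - t) then be - 1 else al - 1) * (z - t).
    by case: ifP => _; ring.
  by rewrite /= !E => /addrI /(two_slopes_inj cbe1 al10 sg0).
- by rewrite (negPf ch1) /u; ring.
- by rewrite (negPf ch2) /u; ring.
- by rewrite eqxx Ebe /u -Eh; ring.
Qed.

Lemma fits_of_separated (h m n : F) : uniq [:: 0; 1; h; m; n] ->
  separated 0 1 h m n -> fits_normalized h m n.
Proof.
rewrite /= !inE !negb_or => /and5P[/and4P[_ h0 m0 n0] /and3P[h1 m1 n1] _ _ _] sep.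
have nh1 : h - 1 != 0 by rewrite subr_eq0 eq_sym.
have [||||f [of_ f1 f2 f3]] := @quadratic_orthomorphism (h / (h - 1)) (- (h / (h - 1)))
  1 h m n 0 0 _ _ _ _ sep.
- by rewrite mulf_neq0 ?invr_eq0 // eq_sym.
- rewrite -subr_eq0 (_ : _ - 1 = (h - 1)^-1) ?invr_eq0 //; by field.
- by rewrite mulr1 subrr.
- by field.
by exists f; split=> //; [rewrite f1 | rewrite f2]; field.
Qed.

(* Here the line through the origin and the point of abscissa [m] is used instead. *)
Lemma fits_of_separated_swap (h m n H D : F) : uniq [:: 0; 1; h; m; n] ->
    (m - 1) * H = m * (n - 1) -> (m - h) * D = m * (n - h) ->
  separated n H D m 0 -> fits_normalized h m n.
Proof.
rewrite /= !inE !negb_or => /and5P[/and4P[_ h0 m0 n0] /and3P[h1 m1 n1] /andP[hm hn] _ _] EH ED sep.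
have nh1 : h - 1 != 0 by rewrite subr_eq0 eq_sym.
have nm1 : m - 1 != 0 by rewrite subr_eq0 eq_sym.
have nmh : m - h != 0 by rewrite subr_eq0 eq_sym.
have nm0 : m != 0 by rewrite eq_sym.
have nh0 : h != 0 by rewrite eq_sym.
(* The slope from the origin to the point of abscissa [m]. [H] and [D] are the abscissae of the
   projections onto this line of the point of abscissa [n]. *)
pose al := h / (h - 1) * (m - 1) / m.
have Eal : al - 1 = (m - h) / ((h - 1) * m) by rewrite /al; field; rewrite nm0 nh1.
have [||||f [of_ f1 f2 f3]] := @quadratic_orthomorphism al 0
  H D m 0 n (h / (h - 1) * (n - 1)) _ _ _ _ sep.
- by rewrite /al !mulf_neq0 ?invr_eq0.
- by rewrite -subr_eq0 Eal mulf_neq0 ?invr_eq0 ?mulf_neq0.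
- rewrite addr0 (_ : al * H = h / (h - 1) / m * ((m - 1) * H)); last first.
    by rewrite /al; field; rewrite nm0 nh1.
  by rewrite EH; field; rewrite nm0 nh1.
- rewrite addr0 Eal (_ : _ * D = ((h - 1) * m)^-1 * ((m - h) * D)); last by field; rewrite nm0 nh1.
  by rewrite ED; field; rewrite nm0 nh1.
exists f; split=> //; first by rewrite f2 mulr0 addr0.
  by rewrite f1 /al; field; rewrite nm0 nh1.
by rewrite f3; field.
Qed.

End QuadraticOrthomorphism.

(** * Orders below 143 *)

Definition addmod (p a b : nat) : nat := (if a + b < p then a + b else a + b - p)%N.
Definition submod (p a b : nat) : nat := (if b <= a then a - b else a + p - b)%N.

(* [None] stands for 0, [Some true] for a nonzero square, [Some false] for a nonsquare. *)
Definition class_table (p : nat) : seq (option bool) :=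
  let sq := mkseq (fun i => (i * i %% p)%N) p in
  mkseq (fun i => if i is 0%N then None else Some (i \in sq)) p.

Fixpoint agree (a b : seq (option bool)) : seq (option bool) :=
  match a, b with
  | x :: a', y :: b' =>
      (match x, y with
       | Some true, Some true => x
       | Some false, Some false => x
       | _, _ => None
       end) :: agree a' b'
  | _, _ => [::]
  end.

(* Forgetting the positions where [a] is [None] makes the innermost loop, [meets], about four
   times shorter. *)
Fixpoint compress (a b : seq (option bool)) : seq bool :=
  match a, b with
  | x :: a', y :: b' =>
      match x, y with
      | None, _ => compress a' b'
      | Some true, Some true => false :: compress a' b'
      | Some false, Some false => false :: compress a' b'
      | _, _ => true :: compress a' b'
      end
  | _, _ => [::]
  end.

Fixpoint meets (a b : seq bool) : bool :=
  match a, b with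
  | x :: a', y :: b' => if x then if y then true else meets a' b' else meets a' b'
  | _, _ => false
  end.

(** Each list gives the values [f 0, ..., f (p - 1)]; it is consulted when none of the three lines
    has an admissible centre. *)
Definition sporadic_orthomorphisms (p : nat) : seq (seq nat) :=
  match p with
  | 11 => [::
      [:: 0; 7; 5; 10; 3; 9; 4; 8; 2; 6; 1];
      [:: 0; 9; 8; 5; 2; 4; 7; 10; 1; 3; 6];
      [:: 0; 7; 9; 2; 5; 3; 8; 10; 1; 6; 4];
      [:: 0; 3; 7; 4; 10; 1; 9; 6; 5; 2; 8];
      [:: 0; 8; 1; 6; 9; 7; 4; 2; 5; 10; 3];
      [:: 0; 3; 7; 4; 10; 9; 2; 6; 5; 1; 8];
      [:: 0; 5; 3; 6; 9; 1; 4; 2; 10; 8; 7];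
      [:: 0; 8; 7; 5; 1; 4; 9; 2; 6; 10; 3];
      [:: 0; 9; 3; 7; 6; 4; 1; 10; 2; 5; 8];
      [:: 0; 5; 10; 4; 9; 7; 1; 3; 6; 8; 2];
      [:: 0; 5; 7; 1; 10; 4; 8; 3; 9; 6; 2]]
  | 13 => [::
      [:: 0; 10; 4; 8; 5; 3; 12; 11; 2; 6; 9; 1; 7];
      [:: 0; 7; 11; 2; 6; 8; 3; 1; 12; 10; 5; 9; 4];
      [:: 0; 10; 5; 2; 6; 12; 3; 11; 9; 1; 8; 4; 7];
      [:: 0; 4; 10; 12; 3; 7; 11; 8; 5; 2; 1; 9; 6];
      [:: 0; 11; 1; 10; 7; 9; 8; 2; 6; 5; 3; 12; 4];
      [:: 0; 6; 12; 10; 8; 3; 2; 9; 7; 4; 11; 1; 5];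
      [:: 0; 10; 7; 4; 3; 11; 8; 2; 6; 12; 1; 5; 9];
      [:: 0; 4; 9; 12; 6; 2; 10; 8; 1; 7; 5; 3; 11];
      [:: 0; 11; 10; 9; 8; 4; 7; 5; 2; 12; 6; 3; 1];
      [:: 0; 5; 4; 12; 9; 6; 1; 10; 2; 7; 3; 8; 11];
      [:: 0; 3; 6; 10; 5; 1; 4; 12; 11; 2; 9; 8; 7]]
  | 17 => [::
      [:: 0; 10; 15; 9; 1; 7; 11; 2; 12; 8; 3; 5; 13; 16; 4; 6; 14];
      [:: 0; 12; 15; 7; 9; 11; 13; 4; 3; 10; 8; 2; 5; 16; 6; 14; 1];
      [:: 0; 9; 15; 10; 8; 16; 3; 12; 7; 4; 11; 13; 5; 2; 6; 1; 14];
      [:: 0; 6; 9; 13; 7; 1; 5; 8; 16; 3; 2; 15; 14; 10; 12; 4; 11];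
      [:: 0; 2; 5; 1; 3; 15; 12; 9; 13; 16; 14; 7; 6; 4; 11; 10; 8]]
  | 23 => [::
      [:: 0; 19; 22; 16; 15; 6; 8; 13; 12; 5; 3; 18; 20; 11; 1; 4; 21; 9; 17; 10; 14; 7; 2];
      [:: 0; 4; 11; 22; 6; 16; 10; 20; 3; 15; 7; 18; 13; 2; 19; 9; 1; 8; 5; 17; 12; 14; 21];
      [:: 0; 18; 13; 11; 10; 9; 4; 3; 17; 22; 5; 8; 15; 20; 16; 2; 7; 6; 19; 1; 12; 14; 21];
      [:: 0; 6; 15; 9; 5; 16; 21; 1; 11; 19; 22; 2; 8; 10; 18; 17; 14; 3; 13; 12; 4; 20; 7];
      [:: 0; 13; 3; 10; 12; 16; 20; 9; 2; 22; 15; 4; 8; 11; 6; 21; 19; 14; 5; 18; 1; 7; 17];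
      [:: 0; 2; 12; 18; 6; 19; 4; 10; 15; 8; 21; 16; 5; 3; 20; 1; 11; 14; 22; 13; 9; 17; 7]]
  | 29 => [::
      [:: 0; 19; 3; 11; 24; 26; 5; 22; 12; 7; 20; 16; 15; 8; 25; 27; 1; 14; 6; 28; 10; 23;
          18; 17; 2; 9; 13; 4; 21];
      [:: 0; 27; 18; 2; 12; 23; 28; 17; 11; 7; 19; 26; 6; 15; 25; 10; 20; 1; 24; 9; 3; 22;
          13; 8; 16; 21; 14; 5; 4];
      [:: 0; 11; 15; 5; 26; 3; 2; 12; 23; 16; 18; 20; 28; 27; 13; 7; 19; 14; 6; 10; 9; 25;
          4; 24; 1; 8; 21; 17; 22]]
  | 31 => [::
      [:: 0; 9; 30; 21; 19; 22; 13; 18; 7; 14; 20; 4; 25; 8; 6; 24; 1; 5; 12; 17; 23; 10;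
          3; 29; 15; 27; 16; 28; 11; 2; 26];
      [:: 0; 26; 10; 27; 23; 8; 2; 30; 20; 6; 16; 21; 7; 28; 13; 19; 25; 18; 29; 24; 3; 11;
          9; 5; 22; 14; 17; 12; 4; 15; 1];
      [:: 0; 27; 30; 14; 10; 4; 18; 29; 9; 16; 15; 20; 2; 17; 1; 7; 26; 5; 21; 3; 28; 23;
          11; 8; 6; 19; 12; 25; 24; 22; 13]]
  | 41 => [::
      [:: 0; 29; 6; 18; 25; 30; 22; 4; 14; 23; 32; 2; 10; 31; 27; 24; 26; 12; 7; 9; 5; 38;
          33; 15; 20; 28; 19; 13; 16; 8; 35; 39; 3; 11; 17; 1; 37; 36; 40; 21; 34];
      [:: 0; 16; 4; 23; 37; 9; 17; 19; 5; 27; 11; 39; 10; 36; 38; 28; 30; 20; 24; 14; 6;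
          12; 32; 3; 2; 33; 7; 26; 13; 22; 35; 40; 8; 21; 18; 1; 25; 31; 34; 29; 15];
      [:: 0; 20; 10; 38; 3; 39; 24; 30; 11; 18; 26; 36; 25; 17; 28; 27; 8; 32; 16; 21; 7;
          6; 2; 4; 13; 15; 31; 22; 14; 12; 37; 1; 33; 9; 40; 23; 5; 34; 29; 35; 19]]
  | _ => [::]
  end%N.

Definition is_orthomorphism_table (p : nat) (g : seq nat) : bool :=
  [&& size g == p, all (fun i => (i < p)%N) g, uniq g
    & uniq (mkseq (fun i => submod p (nth 0%N g i) i) p)].

Section Tables.
Variables (p : nat) (rows : seq (seq (option bool))) (mul : seq (seq nat)).
Let row i := nth [::] rows i.
(** The quotient [b / a], as a position in row [a] of the multiplication table. An absent quotient
    gives the index [p], which has no row, and [meets] then fails. *)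
Let divm a b := index b (nth [::] mul a).
Let mulm a b := nth 0%N (nth [::] mul a) b.

Definition separated_swap_test (h m n : nat) : bool :=
  let a := agree (agree (row n) (row (divm m.-1 (mulm m n.-1))))
                 (row (divm (submod p m h) (mulm m (submod p n h)))) in
  meets (compress a (row m)) (compress a (row 0)).

Definition sporadic_test (h m n : nat) (g : seq nat) : bool :=
  [&& nth 0%N g 0 == 0%N, mulm h.-1 (nth 0%N g m) == mulm h m.-1
    & mulm h.-1 (nth 0%N g n) == mulm h n.-1].

(* [if] rather than [||] because [vm_compute] evaluates the arguments of [||] eagerly. *)
Definition fallback_test (tbl : seq (seq nat)) (h m n : nat) : bool :=
  if separated_swap_test h m n then true
  else if separated_swap_test h n m then true
  else has (sporadic_test h m n) tbl.

Definition main_test (tbl : seq (seq nat)) (h : nat) : bool :=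
  let a := agree (agree (row 0) (row 1)) (row h) in
  pairwise (fun x y => if meets x.2 y.2 then true else fallback_test tbl h x.1 y.1)
    [seq (m, compress a (row m)) | m <- iota 2 (p - 2) & m != h].

End Tables.

(** Row [s] is rotated so that position [i] holds the class of [s + i]; a position thus stands for
    the centre [- i]. *)
Definition small_order_test (p : nat) : bool :=
  let tbl := sporadic_orthomorphisms p in
  let T := class_table p in
  let rows := mkseq (fun s => rot s T) p in
  let mul := mkseq (fun a => traject (addmod p a) 0%N p) p in
  all (is_orthomorphism_table p) tbl && all (main_test p rows mul tbl) (iota 2 (p - 2)).

Lemma small_orders_pass :
  all (fun p => if prime p then small_order_test p else true) (iota 8 135).
Proof. vm_cast_no_check (erefl true). Qed.

(** * Soundness of the computation *)

Lemma quad_char1_square (F : finFieldType) (x : F) : odd #|F| ->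
  quad_char x = 1 -> exists y, x = y ^+ 2.
Proof.
move=> oddF; rewrite /quad_char; case: eqVneq => // nzx; case: eqP => // xk _.
have cardF := odd_card_half oddF; have k_gt0 := half_card_gt0 cardF.
set k := #|F|./2 in cardF xk k_gt0.
have : has k.*2.-primitive_root (enum (predC1 (0 : F))).
  apply: has_prim_root; rewrite ?double_gt0 ?enum_uniq //.
    apply/allP => y; rewrite mem_enum inE unity_rootE => nzy.
    by rewrite -muln2 exprM (expf_half_sqr cardF nzy).
  by rewrite -cardE cardC1 cardF.
case/hasP => z _ prim_z.
have xn1 : x ^+ k.*2 = 1 by rewrite -muln2 exprM xk expr1n.
have [[i _] /= Ei] := prim_rootP prim_z xn1.
(* As [x] is [z ^+ i] with [z] primitive of order [2 k], [x ^+ k = 1] forces [i] to be even. *)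
have : (k.*2 %| i * k)%N.
  by rewrite (prim_order_dvd prim_z) exprM -Ei xk.
rewrite -mul2n dvdn_pmul2r // => /dvdnP[j Ej].
by exists (z ^+ j); rewrite Ei Ej exprM.
Qed.

Definition encode (c : int) : option bool := if c == 0 then None else Some (c == 1).

Lemma encode_quad_char_eq (F : finFieldType) (x y : F) :
  encode (quad_char x) = encode (quad_char y) -> quad_char x = quad_char y.
Proof.
by case: (quad_char_values x) => ->; case: (quad_char_values y) => ->.
Qed.

Lemma size_agree a b : size (agree a b) = minn (size a) (size b).
Proof. by elim: a b => [|x a IH] [|y b] //=; rewrite ?minn0 // IH minnSS. Qed.

Lemma nth_agree a b i s : nth None (agree a b) i = Some s ->
  nth None a i = Some s /\ nth None b i = Some s.
Proof.
elim: a b i => [|x a IH] [|y b] [|i] //=; last exact: IH.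
by case: x => [[]|]; case: y => [[]|].
Qed.

Lemma meets_compressP a b c : meets (compress a b) (compress a c) ->
  exists i s, [/\ (i < size a)%N, (i < size b)%N, (i < size c)%N &
    [/\ nth None a i = Some s, nth None b i != Some s & nth None c i != Some s]].
Proof.
elim: a b c => [|x a IH] [|y b] [|z c] //=.
- by case: x => [[]|]; [case: y => [[]|] | case: y => [[]|] |]; case: compress.
have lift : (exists i s, [/\ (i < size a)%N, (i < size b)%N, (i < size c)%N &
    [/\ nth None a i = Some s, nth None b i != Some s & nth None c i != Some s]]) ->
  exists i s, [/\ (i < (size a).+1)%N, (i < (size b).+1)%N, (i < (size c).+1)%N &
    [/\ nth None (x :: a) i = Some s, nth None (y :: b) i != Some s
      & nth None (z :: c) i != Some s]].
  by case=> i [s h]; exists i.+1, s.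
case: x lift => [s|] lift; last by move=> /IH.
have [Ey|Ny] := eqVneq y (Some s).
  by subst y; case: s lift => lift; case: z lift => [[]|] lift /IH.
have [Ez|Nz] := eqVneq z (Some s).
  by subst z; case: s Ny lift => Ny lift; case: y Ny lift => [[]|] // Ny lift /IH.
by move=> _; exists 0%N, s.
Qed.

Lemma pairwise_sorted_ltn (r : rel nat) s m n : sorted ltn s -> pairwise r s ->
  m \in s -> n \in s -> (m < n)%N -> r m n.
Proof.
elim: s => // x s IH /= pth /andP[/allP rx pr].
have /allP lt_x := order_path_min ltn_trans pth.
rewrite !inE => /orP[/eqP->|ms] /orP[/eqP->|ns] lt.
- by rewrite ltnn in lt.
- exact: rx.
- by have := lt_x _ ms; rewrite /= ltnNge ltnW.
- exact: IH (path_sorted pth) pr ms ns lt.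
Qed.

Section Soundness.
Variable p : nat.
Hypotheses (pr_p : prime p) (odd_p : odd p).

Let pcharFp : p \in [pchar 'F_p] := pchar_Fp pr_p.

Lemma card_Fp_odd : odd #|'F_p|.
Proof. by rewrite card_Fp. Qed.

Lemma Fp_val_lt (x : 'F_p) : (x < p)%N.
Proof. by have := ltn_ord x; rewrite [X in (_ < X)%N]Fp_cast. Qed.

Lemma Fp_valK (x : 'F_p) : (x : nat)%:R = x.
Proof. exact: natr_Zp. Qed.

Lemma Fp_natr_inj i j : (i < p)%N -> (j < p)%N -> i%:R = j%:R :> 'F_p -> i = j.
Proof.
move=> ip jp /(congr1 (@nat_of_ord _)).
by rewrite !val_Fp_nat // !modn_small.
Qed.

Lemma Fp_natr_mod i : (i %% p)%:R = i%:R :> 'F_p.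
Proof. by apply: val_inj; rewrite /= !val_Fp_nat ?modn_mod. Qed.

Lemma addmod_natr a b : (addmod p a b)%:R = a%:R + b%:R :> 'F_p.
Proof.
rewrite /addmod; case: ltnP => h; first by rewrite natrD.
by rewrite natrB // (pcharf0 pcharFp) subr0 natrD.
Qed.

Lemma submod_natr a b : (b < p)%N -> (submod p a b)%:R = a%:R - b%:R :> 'F_p.
Proof.
move=> bp; rewrite /submod; case: ifP => h; first by rewrite natrB.
rewrite natrB; first by rewrite natrD (pcharf0 pcharFp) addr0.
by rewrite (leq_trans (ltnW bp)) // leq_addl.
Qed.

Lemma submod_lt a b : (a < p)%N -> (b < p)%N -> (submod p a b < p)%N.
Proof. by rewrite /submod; case: ifP; lia. Qed.

Let T := class_table p.
Let rows := mkseq (fun s => rot s T) p.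
Let mul := mkseq (fun a => traject (addmod p a) 0%N p) p.

Lemma size_class_table : size T = p. Proof. exact: size_mkseq. Qed.

Lemma nth_class_table i : (i < p)%N -> nth None T i = encode (quad_char (i%:R : 'F_p)).
Proof.
move=> ip; rewrite nth_mkseq //; case: i ip => [|i] ip; first by rewrite quad_char0.
set j := i.+1 in ip *.
have nzj : j%:R != 0 :> 'F_p.
  by apply/eqP => /(Fp_natr_inj ip (prime_gt0 pr_p)).
have -> : (j \in mkseq (fun i0 => (i0 * i0 %% p)%N) p) = (quad_char (j%:R : 'F_p) == 1).
  apply/mapP/eqP => [[l _ Ej]|/(quad_char1_square card_Fp_odd) [y Ey]].
    rewrite Ej Fp_natr_mod natrM -expr2 quad_char_sqr ?card_Fp_odd //.
    apply: contra_neq nzj => l0; by rewrite Ej Fp_natr_mod natrM l0 mul0r.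
  exists (y : nat); first by rewrite mem_iota add0n Fp_val_lt.
  apply: Fp_natr_inj => //; first by rewrite ltn_mod prime_gt0.
  by rewrite Fp_natr_mod natrM !Fp_valK Ey expr2.
by rewrite /encode quad_char_eq0 (negPf nzj).
Qed.

Lemma nth_row_nil s : (p <= s)%N -> nth [::] rows s = [::].
Proof. by move=> h; rewrite nth_default // size_mkseq. Qed.

Lemma size_row s : (s < p)%N -> size (nth [::] rows s) = p.
Proof. by move=> h; rewrite nth_mkseq // size_rot size_class_table. Qed.

Lemma row_lt s i : (i < size (nth [::] rows s))%N -> (s < p)%N.
Proof. by move=> h; rewrite ltnNge; apply: contraL h => /nth_row_nil ->. Qed.

Lemma nth_row s i : (s < p)%N -> (i < p)%N ->
  nth None (nth [::] rows s) i = encode (quad_char (s%:R + i%:R : 'F_p)).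
Proof.
move=> sp ip; rewrite nth_mkseq // /rot nth_cat size_drop size_class_table.
have [lt|ge] := ltnP i (p - s); first by rewrite nth_drop nth_class_table -?natrD //; lia.
rewrite nth_take; last by lia.
rewrite nth_class_table; last by lia.
congr (encode (quad_char _)); rewrite natrB //.
by rewrite natrB ?(ltnW sp) // (pcharf0 pcharFp) sub0r opprK addrC.
Qed.

Lemma separated_of_rows a b c d e :
  let A := agree (agree (nth [::] rows a) (nth [::] rows b)) (nth [::] rows c) in
  meets (compress A (nth [::] rows d)) (compress A (nth [::] rows e)) ->
  [/\ (a < p)%N, (b < p)%N, (c < p)%N & @separated 'F_p a%:R b%:R c%:R d%:R e%:R].
Proof.
move=> A /meets_compressP [i [s [iA id ie [EA Ed Ee]]]].
have [[Ea Eb] Ec] : (nth None (nth [::] rows a) i = Some s /\ nth None (nth [::] rows b) i = Some s)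
    /\ nth None (nth [::] rows c) i = Some s.
  by case/nth_agree: EA => /nth_agree.
move: iA; rewrite !size_agree !leq_min => /andP[/andP[ia ib] ic].
have [ap bp cp] := And3 (row_lt ia) (row_lt ib) (row_lt ic).
have [dp ep] := (row_lt id, row_lt ie).
have ip : (i < p)%N by rewrite -(size_row ap).
move: Ea Eb Ec Ed Ee; rewrite !nth_row // => Ea Eb Ec Ed Ee.
split=> //; exists (- i%:R); rewrite !opprK; split.
- by move: Ea; rewrite /encode; case: eqP.
- by apply: encode_quad_char_eq; rewrite Ea.
- by apply: encode_quad_char_eq; rewrite Ea.
- by apply: contraNneq Ed => ->; rewrite Ea.
- by apply: contraNneq Ee => ->; rewrite Ea.
Qed.

Lemma mulm_natr a b : (a < p)%N -> (b < p)%N ->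
  (nth 0%N (nth [::] mul a) b)%:R = a%:R * b%:R :> 'F_p.
Proof.
move=> ap bp; rewrite nth_mkseq // nth_traject //; elim: b {bp} => [|b IH] /=.
  by rewrite mulr0.
by rewrite addmod_natr IH -natr1 mulrDr mulr1 addrC.
Qed.

Lemma divm_natr a b : (a < p)%N -> (index b (nth [::] mul a) < p)%N ->
  a%:R * (index b (nth [::] mul a))%:R = b%:R :> 'F_p.
Proof.
move=> ap ip; rewrite -mulm_natr //; congr (_ %:R); rewrite nth_index //.
by rewrite -index_mem (leq_trans ip) // nth_mkseq // size_traject.
Qed.

Lemma predn_natr a : (0 < a)%N -> a.-1%:R = a%:R - 1 :> 'F_p.
Proof. by case: a => // a _; rewrite -natr1 addrK. Qed.

Lemma separated_swap_sound (h m n : nat) :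
    (1 < h < p)%N -> (1 < m < p)%N -> (1 < n < p)%N ->
    uniq [:: 0; 1; h%:R; m%:R; n%:R : 'F_p] ->
  separated_swap_test p rows mul h m n -> @fits_normalized 'F_p h%:R m%:R n%:R.
Proof.
move=> /andP[h1 hp] /andP[m1 mp] /andP[n1 np] U /separated_of_rows [_ Hp Dp sep].
have predn_lt i : (i < p)%N -> (i.-1 < p)%N by lia.
apply: fits_of_separated_swap sep => //; first exact: card_Fp_odd.
  rewrite -predn_natr ?(ltnW m1) // divm_natr ?predn_lt // mulm_natr ?predn_lt //.
  by rewrite predn_natr // ltnW.
rewrite -submod_natr // divm_natr ?submod_lt // mulm_natr ?submod_lt //.
by rewrite submod_natr.
Qed.

Lemma sporadic_sound (h m n : nat) (g : seq nat) :
    (1 < h < p)%N -> (1 < m < p)%N -> (1 < n < p)%N ->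
    is_orthomorphism_table p g -> sporadic_test mul h m n g ->
  @fits_normalized 'F_p h%:R m%:R n%:R.
Proof.
move=> /andP[h1 hp] /andP[m1 mp] /andP[n1 np].
move=> /and4P[/eqP sz /allP g_lt Ug Ud] /and3P[/eqP g0 /eqP gm /eqP gn].
have predn_lt i : (i < p)%N -> (i.-1 < p)%N by lia.
have nth_lt i : (i < p)%N -> (nth 0%N g i < p)%N by move=> ip; apply/g_lt/mem_nth; rewrite sz.
have p0 := prime_gt0 pr_p.
have val_natr i : (i < p)%N -> ((i%:R : 'F_p) : nat) = i.
  by move=> ip; rewrite val_Fp_nat // modn_small.
exists (fun x : 'F_p => (nth 0%N g x)%:R); split.
- split=> x y.
    move/(Fp_natr_inj (nth_lt _ (Fp_val_lt x)) (nth_lt _ (Fp_val_lt y)))/eqP.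
    by rewrite nth_uniq ?sz ?Fp_val_lt // => /eqP/val_inj.
  rewrite /= -{2}[x]Fp_valK -{2}[y]Fp_valK -!submod_natr ?Fp_val_lt //.
  have sub_lt (z : 'F_p) := submod_lt (nth_lt _ (Fp_val_lt z)) (Fp_val_lt z).
  move/(Fp_natr_inj (sub_lt x) (sub_lt y)).
  move=> E; apply/val_inj/eqP.
  rewrite -(nth_uniq 0%N _ _ Ud) ?size_mkseq ?Fp_val_lt //.
  by rewrite !nth_mkseq ?Fp_val_lt //; apply/eqP.
- by rewrite g0.
- by rewrite val_natr // -!predn_natr ?(ltnW h1, ltnW m1) // -!mulm_natr ?predn_lt ?nth_lt // gm.
- by rewrite val_natr // -!predn_natr ?(ltnW h1, ltnW n1) // -!mulm_natr ?predn_lt ?nth_lt // gn.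
Qed.

Lemma small_order_sound : small_order_test p ->
  forall h m n : 'F_p, uniq [:: 0; 1; h; m; n] -> fits_normalized h m n.
Proof.
move=> /andP[/allP tblP /allP testP] h m n U.
have swapU (c x y : 'F_p) : uniq [:: 0; 1; c; x; y] = uniq [:: 0; 1; c; y; x].
  by apply: perm_uniq; rewrite !perm_cons (perm_catC [:: x] [:: y]).
(* [pairwise] in [main_test] visits each pair once, in increasing order. *)
wlog lt_mn : m n U / (m < n)%N.
  move=> wl; have [lt|gt|E] := ltngtP m n; [exact: wl | | ].
    apply: fits_normalizedC; apply: wl => //.
    by rewrite swapU.
  by move: U; rewrite (val_inj E) /= !inE eqxx !andbF.
have bounds (x : 'F_p) : 0 != x -> 1 != x -> (1 < x < p)%N.
  move=> x0 x1; rewrite Fp_val_lt andbT; move: x0 x1; rewrite -{1 2}[x]Fp_valK.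
  by case: (nat_of_ord x) => [|[|i]] //; rewrite eqxx.
have := U; rewrite /= !inE !negb_or => /and5P[/and4P[_ h0 m0 n0] /and3P[h1 m1 n1] /andP[hm hn] _ _].
have [bh bm bn] := And3 (bounds _ h0 h1) (bounds _ m0 m1) (bounds _ n0 n1).
have p2 : (2 + (p - 2))%N = p by rewrite subnKC // prime_gt1.
have in_iota (x : 'F_p) : (1 < x < p)%N -> (x : nat) \in iota 2 (p - 2) by rewrite mem_iota p2.
have := testP _ (in_iota _ bh); rewrite /main_test pairwise_map => /pairwise_sorted_ltn.
move=> /(_ (m : nat) (n : nat)) /=; rewrite !mem_filter !in_iota // !andbT.
rewrite sorted_filter ?iota_ltn_sorted //; last exact: ltn_trans.
have nval (x y : 'F_p) : x != y -> (y : nat) != x by apply: contra_neq => E; apply: val_inj.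
rewrite (nval _ _ hm) (nval _ _ hn) => /(_ isT isT isT lt_mn) test.
have U' : uniq [:: 0; 1; (h : nat)%:R; (m : nat)%:R; (n : nat)%:R : 'F_p] by rewrite !Fp_valK.
suff fit : @fits_normalized 'F_p (h : nat)%:R (m : nat)%:R (n : nat)%:R.
  by move: fit; rewrite !Fp_valK.
move: test; rewrite /fallback_test; case: ifP => [/separated_of_rows [_ _ _ sep] _|_].
  exact: (fits_of_separated card_Fp_odd U' sep).
case: ifP => [t1 _|_]; first exact: (separated_swap_sound bh bm bn U' t1).
case: ifP => [t2 _|_ /hasP[g gt t3]]; last exact: (sporadic_sound bh bm bn (tblP _ gt) t3).
apply: fits_normalizedC; apply: (separated_swap_sound bh bn bm) t2.
by rewrite swapU.
Qed.

End Soundness.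

(** * Diagonally cyclic latin squares *)

Lemma three_points_prime_order (p : nat) (x1 y1 x2 y2 x3 y3 : 'F_p) :
    prime p -> (7 < p)%N -> uniq [:: x1; x2; x3] -> uniq [:: y1; y2; y3] ->
    uniq [:: y1 - x1; y2 - x2; y3 - x3] ->
  exists f, [/\ orthomorphism f, f x1 = y1, f x2 = y2 & f x3 = y3].
Proof.
move=> pr_p p_gt7; apply: three_points_orthomorphism => h m n U.
have odd_p : odd p by case: (even_prime pr_p) p_gt7 => [->|].
have [lt|ge] := ltnP p 143; last first.
  have oddF := card_Fp_odd pr_p odd_p.
  by apply: (fits_of_separated oddF U); apply: (separated_large oddF) U; rewrite card_Fp.
have p_in : p \in iota 8 135 by rewrite mem_iota p_gt7.
have /allP/(_ _ p_in) := small_orders_pass; rewrite pr_p => test.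
exact: (small_order_sound pr_p odd_p test U).
Qed.

Lemma three_points_Zp (p : nat) (x1 y1 x2 y2 x3 y3 : 'Z_p) :
    prime p -> (7 < p)%N -> uniq [:: x1; x2; x3] -> uniq [:: y1; y2; y3] ->
    uniq [:: y1 - x1; y2 - x2; y3 - x3] ->
  exists f, [/\ orthomorphism f, f x1 = y1, f x2 = y2 & f x3 = y3].
Proof.
move=> pr_p p_gt7; move: x1 y1 x2 y2 x3 y3.
(* ['F_p] unfolds to ['Z_(pdiv p)], so rewriting [pdiv p] into [p] transports the result. *)
have : forall x1 y1 x2 y2 x3 y3 : 'Z_(pdiv p), uniq [:: x1; x2; x3] ->
    uniq [:: y1; y2; y3] -> uniq [:: y1 - x1; y2 - x2; y3 - x3] ->
    exists f, [/\ orthomorphism f, f x1 = y1, f x2 = y2 & f x3 = y3].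
  by move=> x1 y1 x2 y2 x3 y3; apply: (@three_points_prime_order p).
by rewrite pdiv_id.
Qed.

(** If the differences agreed, the second diagonal would hold [(c - c', c, s)] and the first
    [(0, c, s)]: the same symbol twice in column [c]. *)
Lemma three_diag_diff_neq (p : nat) (c c' s s' : 'Z_p) (P : triples p) :
    partial_latin_square P -> (forall i, P (i, c + i, s + i)) ->
    (forall i, P (i, c' + i, s' + i)) -> c != c' -> s - c != s' - c'.
Proof.
move=> PLS P1 P2; apply: contraNneq => E.
have := P2 (c - c'); rewrite addrCA subrr addr0 (_ : s' + (c - c') = s); last first.
  by rewrite addrCA addrC -E subrK.
move=> h; have := P1 0; rewrite !addr0 => h0.
by have [_ [_ /(_ erefl erefl) /esym/eqP]] := PLS _ _ _ _ _ _ h0 h; rewrite subr_eq0.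
Qed.

Unset Implicit Arguments.

Theorem theorem8 (p : nat) (hp : prime p) (hp7 : (7 < p)%N)
    (c c' c'' s s' s'' : 'Z_p)
    (hc : [/\ c != c', c != c'' & c' != c''])
    (hs : [/\ s != s', s != s'' & s' != s''])
    (hP : partial_latin_square (three_diag c c' c'' s s' s'')) :
  exists L : 'Z_p -> 'Z_p -> 'Z_p,
    [/\ latin_square L, diagonally_cyclic L & contains L (three_diag c c' c'' s s' s'')].
Proof.
case: hc => c12 c13 c23; case: hs => s12 s13 s23.
have in1 i : three_diag c c' c'' s s' s'' (i, c + i, s + i) by exists i; left.
have in2 i : three_diag c c' c'' s s' s'' (i, c' + i, s' + i) by exists i; right; left.
have in3 i : three_diag c c' c'' s s' s'' (i, c'' + i, s'' + i) by exists i; right; right.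
have d12 := three_diag_diff_neq hP in1 in2 c12.
have d13 := three_diag_diff_neq hP in1 in3 c13.
have d23 := three_diag_diff_neq hP in2 in3 c23.
have [|||f [[inj_f inj_g] fc fc' fc'']] := @three_points_Zp p c s c' s' c'' s'' hp hp7.
- by rewrite /= !inE !negb_or c12 c13 c23.
- by rewrite /= !inE !negb_or s12 s13 s23.
- by rewrite /= !inE !negb_or d12 d13 d23.
exists (fun r t => r + f (t - r)); split.
- split=> [r|t]; apply: injF_bij => x y /=; first by move=> /addrI /inj_f /addIr.
  (* A column is controlled by [f x - x], a row by [f]. *)
  have E z : z + f (t - z) = t + (f (t - z) - (t - z)) by ring.
  by rewrite !E => /addrI /inj_g /addrI /oppr_inj.
- by move=> i j; rewrite (_ : j + 1 - (i + 1) = j - i); ring.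
- by move=> r t u [i [|[]] [-> -> ->]]; rewrite addrK ?fc ?fc' ?fc'' addrC.
Qed.
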